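(* Let $k\in\mathbb C$, $k\neq0,-1$, $j\in\mathbb C$, $r\in\mathbb Z$, and put $p=\mathsf p_1(r,j,k)=j+\frac k2-r(k+1)$ and $\ell_{\rm ch}(r',h,k)=r'[(r'-1)(k+1)+h]$. Let $|p,j,k;\tfrac12\rangle=|k-2p,\ell_{\rm ch}(1-r,k-2p,k),k\rangle_{N=2}\otimes|e^{\frac{2j}k(U-F)}\rangle\otimes|0\rangle_{\psi\bar\psi}$ be the Ramond-sector $s\ell(2|1)$ highest-weight state in the realization of $s\ell(2|1)$ given in the context. Then the charged-I singular vectors mapped into the Ramond sector, $$|E(r,j,k)\rangle^{(1),(R)}_{\rm ch}=\begin{cases}E^2_{r}\cdots E^2_{-1}\cdot F^1_{r}F^1_{r+1}\cdots F^1_{0}\,|p,j,k;\tfrac12\rangle,&r\le0,\\ E^1_{-r}\cdots E^1_{-1}\cdot F^2_{-r+1}\cdots F^2_0\,|p,j,k;\tfrac12\rangle,&r\ge1\end{cases}$$ (mode numbers increasing by $1$ from left to right), evaluate as the following tensor products of charged $N=2$ singular vectors with free-field vacua: for $r\le0$, $$|E(r,j,k)\rangle^{(1),(R)}_{\rm ch}=(-1)^r\,\mathcal G_{r-1}\cdots\mathcal G_{-1}|k-2p,\ell_{\rm ch}(1-r,k-2p,k),k\rangle_{N=2}\otimes|e^{\frac{2j}k(U-F)}\rangle\otimes\bar\psi_r\cdots\bar\psi_{-1}|0\rangle_{\psi\bar\psi},$$ and for $r\ge1$, $$|E(r,j,k)\rangle^{(1),(R)}_{\rm ch}=\Bigl(\frac{k+1}2\Bigr)^{r}\mathcal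 Q_{-r+1}\cdots\mathcal Q_0|k-2p,\ell_{\rm ch}(1-r,k-2p,k),k\rangle_{N=2}\otimes|e^{\frac{2j}k(U-F)}\rangle\otimes\psi_{-r+1}\cdots\psi_0|0\rangle_{\psi\bar\psi}.$$
   Context: $N=2$ algebra (twisted form): generators $\mathcal L_n,\mathcal H_n$ (even), $\mathcal G_n,\mathcal Q_n$ (odd), $n\in\mathbb Z$, with $[\mathcal L_m,\mathcal L_n]=(m-n)\mathcal L_{m+n}$, $[\mathcal H_m,\mathcal H_n]=\frac{\mathsf c}3m\delta_{m+n,0}$, $[\mathcal L_m,\mathcal G_n]=(m-n)\mathcal G_{m+n}$, $[\mathcal H_m,\mathcal G_n]=\mathcal G_{m+n}$, $[\mathcal L_m,\mathcal Q_n]=-n\mathcal Q_{m+n}$, $[\mathcal H_m,\mathcal Q_n]=-\mathcal Q_{m+n}$, $[\mathcal L_m,\mathcal H_n]=-n\mathcal H_{m+n}+\frac{\mathsf c}6(m^2+m)\delta_{m+n,0}$, $\{\mathcal G_m,\mathcal Q_n\}=2\mathcal L_{m+n}-2n\mathcal H_{m+n}+\frac{\mathsf c}3(m^2+m)\delta_{m+n,0}$, with $\mathsf c=-3-6k$. Fields: $\mathcal T(z)=\sum\mathcal L_nz^{-n-2}$, $\mathcal G(z)=\sum\mathcal G_nz^{-n-2}$, $\mathcal Q(z)=\sum\mathcal Q_nz^{-n-1}$, $\mathcal H(z)=\sum\mathcal H_nz^{-n-1}$ (sums over $\mathbb Z$). The vector $|h,\ell,k\rangle_{N=2}$ is the highest-weight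 vector of the $N=2$ Verma module: annihilated by $\mathcal Q_{\ge1},\mathcal G_{\ge0},\mathcal L_{\ge1},\mathcal H_{\ge1}$, with $\mathcal H_0=h$, $\mathcal L_0=\ell$ on it. The charged $N=2$ singular vector with label $r'$ (existing for $\ell=\ell_{\rm ch}(r',h,k)$) is $\mathcal Q_{r'}\cdots\mathcal Q_0|h,\ell,k\rangle_{N=2}$ for $r'\le-1$ and $\mathcal G_{-r'}\cdots\mathcal G_{-1}|h,\ell,k\rangle_{N=2}$ for $r'\ge1$. Free fields: $\partial F(z)\partial F(w)\sim\frac{-k/2}{(z-w)^2}$, $\partial U(z)\partial U(w)\sim\frac{k/2}{(z-w)^2}$, $\psi(z)\bar\psi(w)\sim\frac1{z-w}$, all other products among them and with the $N=2$ fields being trivial. $|e^{a(U-F)}\rangle$ is the primary state corresponding to the vertex operator $e^{a(U-F)}$, i.e. the Fock vacuum annihilated by the positive modes of $\partial F,\partial U$, with zero modes $(\partial U)_0=(\partial F)_0=ka/2$. $\psi(z)=\sum_{n\in\mathbb Z}\psi_nz^{-n}$, $\bar\psi(z)=\sum_{n\in\mathbb Z}\bar\psi_nz^{-n-1}$, $\psi_{\ge1}|0\rangle_{\psi\bar\psi}=\bar\psi_{\ge0}|0\rangle_{\psi\bar\psi}=0$. Realization of the level-$k$ affine $s\ell(2|1)$ currents $C(z)=\sum_{n\in\mathbb Z}C_nz^{-n-1}$ (only the fermionic ones are needed here): $E^1=\psi e^{\frac1k(U-F)}$, $E^2=\bar\psi e^{\frac1k(U-F)}$, $F^1=(\mathcal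 G-\bar\psi\,\partial F-\frac12\mathcal H\bar\psi-(k+\frac12)\partial\bar\psi)e^{-\frac1k(U-F)}$, $F^2=(\frac12(k+1)\mathcal Q+\psi\,\partial F-\frac12\mathcal H\psi+(k+\frac12)\partial\psi)e^{-\frac1k(U-F)}$, where every term is multiplied by the vertex operator and normal ordered, nested from right to left as $:\!A:\!BC\!:\,:$.
   Formalization: For r≤0 the free-field vacuum on the right is |e^{((2j-1)/k)(U-F)}⟩, not the printed |e^{(2j/k)(U-F)}⟩: the 1-r factors F^1 and -r factors E^2 shift the momentum by -1/k. Signs are for an odd N=2 highest-weight vector. *)

(* Defs.v *)
From HB Require Import structures.
From mathcomp Require Import all_boot all_order all_algebra.
From mathcomp Require Import complex.
From mathcomp Require Import boolp classical_sets fsbigop reals.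
From mathcomp Require Import finmap monalg.

Set Implicit Arguments.
Unset Strict Implicit.
Unset Printing Implicit Defensive.

Import GRing.Theory Num.Theory.
Local Open Scope classical_set_scope.
Local Open Scope ring_scope.
Local Open Scope quotient_scope.

Section QuotientModule.
Variables (K : fieldType) (V : lmodType K) (S : set V).

Inductive qspan : V -> Prop :=
| qspan0 : qspan 0
| qspanZD c x y : S x -> qspan y -> qspan (c *: x + y).

Lemma qspanD x y : qspan x -> qspan y -> qspan (x + y).
Proof.
move=> sx sy; elim: sx => [|c u v Su _ IH]; first by rewrite add0r.
by rewrite -addrA; apply: qspanZD.
Qed.

Lemma qspanZ c x : qspan x -> qspan (c *: x).
Proof.
elim=> [|d u v Su _ IH]; first by rewrite scaler0; apply: qspan0.
by rewrite scalerDr scalerA; apply: qspanZD.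
Qed.

Lemma qspanN x : qspan x -> qspan (- x).
Proof. by rewrite -scaleN1r; apply: qspanZ. Qed.

Definition qeq (x y : V) : bool := `[< qspan (x - y) >].

Lemma qeq_refl : reflexive qeq.
Proof. by move=> x; apply/asboolP; rewrite subrr; apply: qspan0. Qed.

Lemma qeq_sym : symmetric qeq.
Proof.
by move=> x y; apply/asboolP/asboolP => s; rewrite -opprB; apply: qspanN.
Qed.

Lemma qeq_trans : transitive qeq.
Proof.
move=> y x z /asboolP sxy /asboolP syz; apply/asboolP.
by rewrite -(subrK y x) -addrA; apply: qspanD.
Qed.

Canonical qeq_equiv := EquivRel qeq qeq_refl qeq_sym qeq_trans.

Definition quotmod : Type := {eq_quot qeq_equiv}.
HB.instance Definition _ := Choice.on quotmod.

Definition qpi (x : V) : quotmod := \pi_{eq_quot qeq_equiv} x.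
Definition qrepr (q : quotmod) : V := repr q.

Lemma qreprK : cancel qrepr qpi. Proof. exact: reprK. Qed.

Lemma qpi_eq x y : (qpi x = qpi y) <-> qspan (x - y).
Proof.
rewrite /qpi; split=> [/eqmodP/asboolP // | s].
by apply/eqmodP/asboolP.
Qed.

Lemma qrepr_qpi x : qspan (qrepr (qpi x) - x).
Proof. by apply/qpi_eq; rewrite qreprK. Qed.

Definition qadd (p q : quotmod) : quotmod := qpi (qrepr p + qrepr q).
Definition qopp (p : quotmod) : quotmod := qpi (- qrepr p).
Definition qscale (c : K) (p : quotmod) : quotmod := qpi (c *: qrepr p).

Lemma qpi_add x y : qadd (qpi x) (qpi y) = qpi (x + y).
Proof.
apply/qpi_eq; rewrite opprD addrACA; apply: qspanD; exact: qrepr_qpi.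
Qed.

Lemma qpi_opp x : qopp (qpi x) = qpi (- x).
Proof. by apply/qpi_eq; rewrite -opprD; apply: qspanN; apply: qrepr_qpi. Qed.

Lemma qpi_scale c x : qscale c (qpi x) = qpi (c *: x).
Proof. by apply/qpi_eq; rewrite -scalerBr; apply: qspanZ; apply: qrepr_qpi. Qed.

Lemma qaddA : associative qadd.
Proof.
move=> p q r; rewrite -[p]qreprK -[q]qreprK -[r]qreprK.
by rewrite !qpi_add addrA.
Qed.

Lemma qaddC : commutative qadd.
Proof. by move=> p q; rewrite /qadd addrC. Qed.

Lemma qadd0 : left_id (qpi 0) qadd.
Proof. by move=> p; rewrite -[p]qreprK qpi_add add0r. Qed.

Lemma qaddN : left_inverse (qpi 0) qopp qadd.
Proof. by move=> p; rewrite -[p]qreprK qpi_opp qpi_add addNr. Qed.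

HB.instance Definition _ :=
  GRing.isZmodule.Build quotmod qaddA qaddC qadd0 qaddN.

Lemma qscaleA a b p : qscale a (qscale b p) = qscale (a * b) p.
Proof. by rewrite -[p]qreprK !qpi_scale scalerA. Qed.

Lemma qscale1 : left_id 1 qscale.
Proof. by move=> p; rewrite -[p]qreprK qpi_scale scale1r. Qed.

Lemma qscaleDr : right_distributive qscale +%R.
Proof.
move=> a p q; rewrite -[p]qreprK -[q]qreprK.
change (qscale a (qadd (qpi (qrepr p)) (qpi (qrepr q)))
  = qadd (qscale a (qpi (qrepr p))) (qscale a (qpi (qrepr q)))).
by rewrite !(qpi_add, qpi_scale) scalerDr.
Qed.

Lemma qscaleDl p : {morph qscale^~ p : a b / a + b}.
Proof.
move=> a b; rewrite -[p]qreprK.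
change (qscale (a + b) (qpi (qrepr p))
  = qadd (qscale a (qpi (qrepr p))) (qscale b (qpi (qrepr p)))).
by rewrite !(qpi_add, qpi_scale) scalerDl.
Qed.

HB.instance Definition _ :=
  GRing.Zmodule_isLmodule.Build K quotmod qscaleA qscale1 qscaleDr qscaleDl.

Lemma qpi_is_linear : linear qpi.
Proof. by move=> c x y; rewrite -qpi_add -qpi_scale. Qed.

HB.instance Definition _ :=
  GRing.isLinear.Build K V quotmod _ qpi qpi_is_linear.

End QuotientModule.

Section Linext.
Variables (K : fieldType) (X : choiceType) (W : lmodType K).

(* Linear extension of a map given on the basis X of the free vector space.   *)
Definition linext (f : X -> W) (x : {malg K[X]}) : W :=
  \sum_(y <- msupp x) x@_y *: f y.

End Linext.

(* The tensor product is the free space on M * N modulo bilinearity.          *)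
Section Tensor.
Variables (K : fieldType) (M N : lmodType K).

Definition tfree : lmodType K := {malg K[(M * N)%type]}.

Definition tpair (m : M) (n : N) : tfree := << (m, n) >>.

Inductive tens_rel : tfree -> Prop :=
| tens_Dl m m' n : tens_rel (tpair (m + m') n - (tpair m n + tpair m' n))
| tens_Dr m n n' : tens_rel (tpair m (n + n') - (tpair m n + tpair m n'))
| tens_Zl c m n : tens_rel (tpair (c *: m) n - c *: tpair m n)
| tens_Zr c m n : tens_rel (tpair m (c *: n) - c *: tpair m n).

Definition tensmod : lmodType K := quotmod (tens_rel : set tfree).

Definition tens (m : M) (n : N) : tensmod := qpi _ (tpair m n).

End Tensor.

(* f (x) g, for linear f and g (no Koszul sign).                              *)
Definition tmap (K : fieldType) (M N M' N' : lmodType K)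
    (f : M -> M') (g : N -> N') (t : tensmod M N) : tensmod M' N' :=
  linext (fun u : M * N => tens (f u.1) (g u.2)) (qrepr t).

Section CyclicModule.
Variables (K : fieldType) (X : choiceType).

Definition freealg : lalgType K := {malg K[{fmonom X}]}.

Definition gen (x : X) : freealg := << fmu x >>.

Definition comm (x y : freealg) : freealg := x * y - y * x.
Definition acomm (x y : freealg) : freealg := x * y + y * x.

(* rel u v: the defining relation u = v of the algebra.
   ann u: u annihilates the cyclic vector.                                    *)
Variables (rel : freealg -> freealg -> Prop) (ann : freealg -> Prop).

Inductive cyc_rel : freealg -> Prop :=
| cyc_of_rel a u v b : rel u v -> cyc_rel (a * (u - v) * b)
| cyc_of_ann a u : ann u -> cyc_rel (a * u).

(* The module induced from the character that ann encodes:
   U / (U . ann), with U = freealg / (rel).                                   *)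
Definition cycmod : lmodType K := quotmod (cyc_rel : set freealg).

Definition cycvec : cycmod := qpi _ (1 : freealg).

Definition act (a : freealg) (m : cycmod) : cycmod := qpi _ (a * qrepr m).

(* Multiplies x_1 ... x_s |cyclic vector> by (-1)^(number of odd x_i).        *)
Definition grade (odd : pred X) (m : cycmod) : cycmod :=
  qpi _ (linext (fun w : {fmonom X} =>
    ((-1) ^+ count odd w *: << w >>) : freealg) (qrepr m)).

End CyclicModule.

Inductive n2gen := n2L of int | n2H of int | n2G of int | n2Q of int.

Definition n2gen_code (x : n2gen) : nat * int :=
  match x with
  | n2L n => (0%N, n) | n2H n => (1%N, n)
  | n2G n => (2%N, n) | n2Q n => (3%N, n)
  end.
Definition n2gen_decode (c : nat * int) : n2gen :=
  match c with
  | (0%N, n) => n2L n | (1%N, n) => n2H n | (2%N, n) => n2G n | (_, n) => n2Q n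
  end.
Lemma n2gen_codeK : cancel n2gen_code n2gen_decode. Proof. by case. Qed.
HB.instance Definition _ := Choice.copy n2gen (can_type n2gen_codeK).

Definition n2odd (x : n2gen) : bool :=
  match x with n2G _ | n2Q _ => true | _ => false end.

Section N2.
Variables (K : fieldType) (k : K).

Local Notation A := (freealg K n2gen).
Local Notation L n := (gen K (n2L n)).
Local Notation H n := (gen K (n2H n)).
Local Notation G n := (gen K (n2G n)).
Local Notation Q n := (gen K (n2Q n)).
Local Notation delta m := (((m : int) == 0)%:R : K).
Local Notation "m %:K" := ((m : int)%:~R : K) (at level 2, format "m %:K").

Definition central_charge : K := - 3%:R - 6%:R * k.
Local Notation c := central_charge.

Inductive n2_rel : A -> A -> Prop :=
| n2_LL m n : n2_rel (comm (L m) (L n)) ((m - n)%:K *: L (m + n))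
| n2_HH m n : n2_rel (comm (H m) (H n)) (c / 3%:R * m%:K * delta (m + n))%:A
| n2_LG m n : n2_rel (comm (L m) (G n)) ((m - n)%:K *: G (m + n))
| n2_HG m n : n2_rel (comm (H m) (G n)) (G (m + n))
| n2_LQ m n : n2_rel (comm (L m) (Q n)) (- n%:K *: Q (m + n))
| n2_HQ m n : n2_rel (comm (H m) (Q n)) (- Q (m + n))
| n2_LH m n : n2_rel (comm (L m) (H n))
    (- n%:K *: H (m + n) + (c / 6%:R * (m ^+ 2 + m)%:K * delta (m + n))%:A)
| n2_GQ m n : n2_rel (acomm (G m) (Q n))
    (2%:R *: L (m + n) - (2%:R * n%:K) *: H (m + n)
     + (c / 3%:R * (m ^+ 2 + m)%:K * delta (m + n))%:A)
| n2_GG m n : n2_rel (acomm (G m) (G n)) 0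
| n2_QQ m n : n2_rel (acomm (Q m) (Q n)) 0.

Variables (h l : K).

Inductive n2_hw : A -> Prop :=
| n2_hwQ n : 1 <= n -> n2_hw (Q n)
| n2_hwG n : 0 <= n -> n2_hw (G n)
| n2_hwL n : 1 <= n -> n2_hw (L n)
| n2_hwH n : 1 <= n -> n2_hw (H n)
| n2_hwH0 : n2_hw (H 0 - h%:A)
| n2_hwL0 : n2_hw (L 0 - l%:A).

Definition verma : lmodType K := cycmod n2_rel n2_hw.
Definition vhw : verma := cycvec n2_rel n2_hw.

Definition opH (n : int) : verma -> verma := act (H n).
Definition opG (n : int) : verma -> verma := act (G n).
Definition opQ (n : int) : verma -> verma := act (Q n).

(* Parity operator of the super vector space verma. The highest-weight vector is
   ODD: this convention fixes the relative sign between the odd N = 2 modes and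
   the free fermions.                                                         *)
Definition vpar (m : verma) : verma := - grade n2odd m.

End N2.

(* bfock below is the direct sum over a in K of the Fock modules over
   |e^{a(U-F)}>.
   bS b is the zero-mode translation of e^{b(U-F)}; |e^{a(U-F)}> is S_a |0>.  *)
Inductive bgen (K : Type) := bF of int | bU of int | bS of K.
Arguments bF {K}. Arguments bU {K}.

Section BGenChoice.
Variable K : choiceType.
Definition bgen_code (x : bgen K) : int + int + K :=
  match x with bF n => inl (inl n) | bU n => inl (inr n) | bS b => inr b end.
Definition bgen_decode (c : int + int + K) : bgen K :=
  match c with inl (inl n) => bF n | inl (inr n) => bU n | inr b => bS b end.
Lemma bgen_codeK : cancel bgen_code bgen_decode. Proof. by case. Qed.
HB.instance Definition _ := Choice.copy (bgen K) (can_type bgen_codeK).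
End BGenChoice.

Section ExpSeries.
Variables (K : fieldType) (W : lmodType K) (t : nat -> W -> W).

(* Coefficient of z^m in (\sum_(n >= 1) t_n z^n)^s.                           *)
Fixpoint serpow (s m : nat) (w : W) : W :=
  if s is s'.+1 then \sum_(i < m) t i.+1 (serpow s' (m - i.+1)%N w)
  else if m == 0%N then w else 0.

(* Coefficient of z^m in exp (\sum_(n >= 1) t_n z^n).                         *)
Definition expser (m : nat) (w : W) : W :=
  \sum_(s < m.+1) (s`!%:R)^-1 *: serpow s m w.

End ExpSeries.

Section Bosons.
Variables (K : fieldType) (k : K).

Local Notation A := (freealg K (bgen K)).
Local Notation dF n := (gen K (bF n)).
Local Notation dU n := (gen K (bU n)).
Local Notation S b := (gen K (bS b)).
Local Notation delta m := (((m : int) == 0)%:R : K).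
Local Notation "m %:K" := ((m : int)%:~R : K) (at level 2, format "m %:K").

Inductive b_rel : A -> A -> Prop :=
| b_FF m n : b_rel (comm (dF m) (dF n)) (- (k / 2%:R) * m%:K * delta (m + n))%:A
| b_UU m n : b_rel (comm (dU m) (dU n)) (k / 2%:R * m%:K * delta (m + n))%:A
| b_FU m n : b_rel (comm (dF m) (dU n)) 0
| b_FS m b : b_rel (comm (dF m) (S b)) ((k * b / 2%:R * delta m) *: S b)
| b_US m b : b_rel (comm (dU m) (S b)) ((k * b / 2%:R * delta m) *: S b)
| b_SS a b : b_rel (S a * S b) (S (a + b))
| b_S0 : b_rel (S 0) 1.

Inductive b_vac : A -> Prop :=
| b_vacF n : 0 <= n -> b_vac (dF n)
| b_vacU n : 0 <= n -> b_vac (dU n).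

Definition bfock : lmodType K := cycmod b_rel b_vac.

Definition opF (n : int) : bfock -> bfock := act (dF n).
Definition opU (n : int) : bfock -> bfock := act (dU n).
Definition opS (b : K) : bfock -> bfock := act (S b).

Definition bvac (a : K) : bfock := opS a (cycvec b_rel b_vac).

Definition opUF (n : int) (w : bfock) : bfock := opU n w - opF n w.

(* Coefficient of z^(-n-1) in
     e^{b(U-F)}(z) = exp( b \sum_(i >= 1) (dU - dF)_{-i} z^i / i) S_b
                     exp(-b \sum_(i >= 1) (dU - dF)_i z^(-i) / i);
   the further factor z^{b (dU - dF)_0} is 1 on bfock.                        *)
Definition vop (b : K) (n : int) (w : bfock) : bfock :=
  \sum_(pq \in [set pq : nat * nat | (pq.1 : int) - (pq.2 : int) = - n - 1])
    expser (fun i v => (b / i%:R) *: opUF (- (i : int)) v) pq.1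
      (opS b (expser (fun i v => - (b / i%:R) *: opUF i v) pq.2 w)).

End Bosons.

Inductive fgen := fpsi of int | fbpsi of int.

Definition fgen_code (x : fgen) : int + int :=
  match x with fpsi n => inl n | fbpsi n => inr n end.
Definition fgen_decode (c : int + int) : fgen :=
  match c with inl n => fpsi n | inr n => fbpsi n end.
Lemma fgen_codeK : cancel fgen_code fgen_decode. Proof. by case. Qed.
HB.instance Definition _ := Choice.copy fgen (can_type fgen_codeK).

Section Fermions.
Variable K : fieldType.

Local Notation A := (freealg K fgen).
Local Notation psi n := (gen K (fpsi n)).
Local Notation bpsi n := (gen K (fbpsi n)).

Inductive f_rel : A -> A -> Prop :=
| f_pb m n : f_rel (acomm (psi m) (bpsi n)) ((m + n == 0)%:R : K)%:A
| f_pp m n : f_rel (acomm (psi m) (psi n)) 0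
| f_bb m n : f_rel (acomm (bpsi m) (bpsi n)) 0.

Inductive f_vac : A -> Prop :=
| f_vacp n : 1 <= n -> f_vac (psi n)
| f_vacb n : 0 <= n -> f_vac (bpsi n).

Definition ffock : lmodType K := cycmod f_rel f_vac.
Definition fvac : ffock := cycvec f_rel f_vac.

Definition oppsi (n : int) : ffock -> ffock := act (psi n).
Definition opbpsi (n : int) : ffock -> ffock := act (bpsi n).

End Fermions.

(* mode A n is the coefficient of z^(-n-1) of A(z), whatever the conformal
   weight used in the customary mode numbering of A.                          *)
Record vfield (W : Type) := VField { fodd : bool; mode : int -> W -> W }.

Section Fields.
Variables (K : fieldType) (W : lmodType K).
Implicit Types A B : vfield W.

Definition dfield A : vfield W :=
  VField (fodd A) (fun n w => - (n%:~R : K) *: mode A (n - 1) w).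

(* :AB:. The sums over m are finite on every vector for the fields used here. *)
Definition nop A B : vfield W :=
  VField (fodd A (+) fodd B) (fun n w =>
    \sum_(m \in [set m : int | m < 0]) mode A m (mode B (n - m - 1) w)
    + (-1) ^+ (fodd A && fodd B) *:
      \sum_(m \in [set m : int | 0 <= m]) mode B (n - m - 1) (mode A m w)).

End Fields.

(* A_m A_(m+1) ... A_n w; the product is empty when n < m.                    *)
Definition modes (W : Type) (A : int -> W -> W) (m n : int) (w : W) : W :=
  if m <= n then
    foldr (fun (i : nat) v => A (m + (i : int)) v) w (iota 0 (absz (n - m + 1)))
  else w.

Section Realization.
Variables (K : fieldType) (k h l : K).

Definition ramond_space : lmodType K :=
  tensmod (tensmod (verma k h l) (bfock k)) (ffock K).

Definition state (m : verma k h l) (b : bfock k) (f : ffock K) : ramond_space :=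
  tens (tens m b) f.

Definition on_n2 (X : verma k h l -> verma k h l) : ramond_space
    -> ramond_space :=
  tmap (tmap X id) id.
Definition on_bos (X : bfock k -> bfock k) : ramond_space -> ramond_space :=
  tmap (tmap id X) id.
(* For odd X: Koszul sign from moving X past the N = 2 factor.                *)
Definition on_ferm (X : ffock K -> ffock K) : ramond_space -> ramond_space :=
  tmap (tmap (@vpar K k h l) id) X.

Definition fieldH : vfield ramond_space :=
  VField false (fun n => on_n2 (@opH K k h l n)).
(* G(z) = \sum_n G_n z^(-n-2). *)
Definition fieldG : vfield ramond_space :=
  VField true (fun n => on_n2 (@opG K k h l (n - 1))).
Definition fieldQ : vfield ramond_space :=
  VField true (fun n => on_n2 (@opQ K k h l n)).
Definition field_dF : vfield ramond_space :=
  VField false (fun n => on_bos (@opF K k n)).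
Definition fieldV (b : K) : vfield ramond_space :=
  VField false (fun n => on_bos (@vop K k b n)).
(* psi(z) = \sum_n psi_n z^(-n). *)
Definition field_psi : vfield ramond_space :=
  VField true (fun n => on_ferm (@oppsi K (n + 1))).
Definition field_bpsi : vfield ramond_space :=
  VField true (fun n => on_ferm (@opbpsi K n)).

Local Notation Vplus := (fieldV k^-1).
Local Notation Vminus := (fieldV (- k^-1)).
Local Notation ":[ A , B ]:" := (nop A B) (at level 0).

Definition curE1 (n : int) (w : ramond_space) : ramond_space :=
  mode :[ field_psi, Vplus ]: n w.

Definition curE2 (n : int) (w : ramond_space) : ramond_space :=
  mode :[ field_bpsi, Vplus ]: n w.

Definition curF1 (n : int) (w : ramond_space) : ramond_space :=
  mode :[ fieldG, Vminus ]: n w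
  - mode :[ field_bpsi, :[ field_dF, Vminus ]: ]: n w
  - 2%:R^-1 *: mode :[ fieldH, :[ field_bpsi, Vminus ]: ]: n w
  - (k + 2%:R^-1) *: mode :[ dfield field_bpsi, Vminus ]: n w.

Definition curF2 (n : int) (w : ramond_space) : ramond_space :=
  ((k + 1) / 2%:R) *: mode :[ fieldQ, Vminus ]: n w
  + mode :[ field_psi, :[ field_dF, Vminus ]: ]: n w
  - 2%:R^-1 *: mode :[ fieldH, :[ field_psi, Vminus ]: ]: n w
  + (k + 2%:R^-1) *: mode :[ dfield field_psi, Vminus ]: n w.

End Realization.

Section ChargedSingular.
Variables (K : fieldType).

Definition p1 (r : int) (j k : K) : K := j + k / 2%:R - r%:~R * (k + 1).

Definition ell_ch (r : int) (h k : K) : K :=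
  r%:~R * ((r%:~R - 1) * (k + 1) + h).

Variables (r : int) (j k : K).

Definition n2h : K := k - 2%:R * p1 r j k.
Definition n2l : K := ell_ch (1 - r) n2h k.

(* |p, j, k; 1/2> *)
Definition ramond_hw : ramond_space k n2h n2l :=
  state (vhw k n2h n2l) (bvac k (2%:R * j / k)) (fvac K).

(* |E(r, j, k)>^{(1),(R)}_ch *)
Definition Ech : ramond_space k n2h n2l :=
  if r <= 0 then
    modes (@curE2 K k n2h n2l) r (- 1)
      (modes (@curF1 K k n2h n2l) r 0 ramond_hw)
  else
    modes (@curE1 K k n2h n2l) (- r) (- 1)
      (modes (@curF2 K k n2h n2l) (- r + 1) 0 ramond_hw).

End ChargedSingular.

(* Main.v *)
(* The two cases are the same computation, for (G, bpsi, E^2, F^1) and for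
   (Q, psi, E^1, F^2); write (Gam, chi, E, F), and let n be the number of E's.
   The modes of E and F anticommute. The only non-trivial OPE between their
   constituents is that of dF with the vertex operator in E; it gives a double
   sum of chi_p chi_t against modes of :e^((U-F)/k) e^(-(U-F)/k): that depend on
   p + t only, and this sum vanishes by antisymmetry. Hence the E's can be moved to
   the right. On the highest-weight state they give chi_(-n) ... chi_(-1) and
   shift the momentum by n/k. After that, chi_p kills the state for p >= -n, so
   that F_(-s) with s < n acts as Gam_(-s) times the shift of momentum by -1/k.
   For s = n, which happens only in the case r <= 0, F_(-n) also contributes a
   multiple of chi_(-n-1); its coefficient
   - j - (h + n)/2 - (k + 1/2) n,  h = k - 2p,
   is zero exactly because p = p_1(-n, j, k). *)
Require Import Defs.
From HB Require Import structures.
From mathcomp Require Import all_boot all_order all_algebra.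
From mathcomp Require Import complex.
From mathcomp Require Import boolp classical_sets fsbigop reals.
From mathcomp Require Import finmap monalg.
From mathcomp Require Import zify ring.

Set Implicit Arguments.
Unset Strict Implicit.
Unset Printing Implicit Defensive.

Import Order.TTheory GRing.Theory Num.Theory.
Local Open Scope classical_set_scope.
Local Open Scope ring_scope.

(** * Linear maps, quotients and cyclic modules *)

(** The modules are quotients of free algebras, with no basis at hand. None is needed: the claim is
    an equation, so it is enough to move modes past each other and to use the annihilation
    conditions, while statements about all vectors follow by induction from the cyclic vector. The
    obstacle is the infinite sums. A sum over an infinite set of integers is 0 by default when
    infinitely many terms are nonzero, so linearity and splitting hold only once finiteness on each
    vector is known. This is why operators are carried together with [isfield], and why smoothness
    of all three modules has to be proved. The same care governs the cancellation of the double sum: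
    besides being antisymmetric, its terms must vanish outside a finite square before the two
    summations may be exchanged. As for the signs, the highest-weight vector is odd, so each chi
    that crosses it contributes -1. With n factors E and M factors F the total sign is (-1)^(Mn +
    n), where Mn comes from the reordering; it equals (-1)^n for M = n + 1, and 1 for M = n. *)

Section LinearMaps.
Variables (K : fieldType) (U V W : lmodType K).
Implicit Types (f : U -> V) (g : V -> W).

(** The modes and [tmap] are bare functions, so linearity is used as a predicate and its usual
    consequences are restated for it. *)
Lemma lin0 f : linear f -> f 0 = 0.
Proof. by move=> lf; have := lf (-1) 0 0; rewrite scaler0 addr0 scaleN1r addNr. Qed.

Lemma linD f u v : linear f -> f (u + v) = f u + f v.
Proof. by move=> lf; rewrite -{1}(scale1r u) lf scale1r. Qed.

Lemma linZ f c u : linear f -> f (c *: u) = c *: f u.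
Proof. by move=> lf; rewrite -[c *: u]addr0 lf lin0 ?addr0. Qed.

Lemma linN f u : linear f -> f (- u) = - f u.
Proof. by move=> lf; rewrite -scaleN1r linZ // scaleN1r. Qed.

Lemma linB f u v : linear f -> f (u - v) = f u - f v.
Proof. by move=> lf; rewrite linD // linN. Qed.

Lemma lin_sum f (I : Type) (r : seq I) (P : pred I) (F : I -> U) :
  linear f -> f (\sum_(i <- r | P i) F i) = \sum_(i <- r | P i) f (F i).
Proof.
move=> lf; elim/big_rec2: _ => [|i y1 y2 _ <-]; first exact: lin0.
exact: linD.
Qed.

Lemma lin_comp f g : linear f -> linear g -> linear (g \o f).
Proof. by move=> lf lg c u v /=; rewrite lf lg. Qed.

End LinearMaps.

Section LinearCombinations.
Variables (K : fieldType) (U V : lmodType K).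
Implicit Types (f g : U -> V).

Lemma lin_add f g : linear f -> linear g -> linear (fun u => f u + g u).
Proof. by move=> lf lg c u v; rewrite lf lg scalerDr addrACA. Qed.

Lemma lin_scale a f : linear f -> linear (fun u => a *: f u).
Proof. by move=> lf c u v; rewrite lf scalerDr !scalerA mulrC. Qed.

Lemma lin_opp f : linear f -> linear (fun u => - f u).
Proof. by move=> lf c u v; rewrite lf opprD scalerN. Qed.

Lemma eigen_scale (f : U -> U) e c u : linear f -> f u = e *: u ->
  f (c *: u) = e *: (c *: u).
Proof. by move=> lf fu; rewrite linZ // fu !scalerA mulrC. Qed.

Lemma eigen_add (f : U -> U) e u v : linear f -> f u = e *: u -> f v = e *: v ->
  f (u + v) = e *: (u + v).
Proof. by move=> lf fu fv; rewrite linD // fu fv scalerDr. Qed.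

Lemma lin_zero : linear (fun _ : U => 0 : V).
Proof. by move=> c u v; rewrite scaler0 addr0. Qed.

Lemma lin_bigsum (I : Type) (r : seq I) (P : pred I) (F : I -> U -> V) :
  (forall i, P i -> linear (F i)) -> linear (fun u => \sum_(i <- r | P i) F i u).
Proof.
move=> lF c u v; rewrite scaler_sumr -big_split /=.
by apply: eq_bigr => i Pi; rewrite lF.
Qed.

End LinearCombinations.

Lemma lin_id (K : fieldType) (U : lmodType K) : linear (@id U).
Proof. by []. Qed.

Section Linext.
Variables (K : fieldType) (X : choiceType) (W : lmodType K).
Implicit Types (f : X -> W) (x : {malg K[X]}).

Lemma malg_ind (P : {malg K[X]} -> Prop) :
  P 0 -> (forall c y x, P x -> P (c *: << y >> + x)) -> forall x, P x.
Proof.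
move=> P0 PD x; rewrite (monalgE x); elim/big_rec: _ => // y z _ Pz.
suff -> : << x@_y *g y >> = x@_y *: << y >> :> {malg K[X]} by apply: PD.
apply/malgP => t; rewrite mcoeffZ !mcoeffU.
by case: eqP; rewrite ?mulr1 ?mulr0.
Qed.

(** The support in [linext] varies with the vector; a common finite superset makes the sums for
    different vectors comparable. *)
Lemma linextEw f x (d : {fset X}) : (msupp x `<=` d)%fset ->
  linext f x = \sum_(y <- d) x@_y *: f y.
Proof.
move=> le; rewrite [LHS](big_fset_incl _ le) => //= y _ /mcoeff_outdom ->.
by rewrite scale0r.
Qed.

Lemma linextU f y : linext f << y >> = f y.
Proof.
by rewrite (@linextEw _ _ [fset y]%fset) ?msuppU_le // big_seq_fset1 mcoeffUU scale1r.
Qed.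

Lemma linext_linear f : linear (linext f).
Proof.
move=> c x y; pose d := (msupp (c *: x + y) `|` (msupp x `|` msupp y))%fset.
have lexy : (msupp x `|` msupp y `<=` d)%fset by apply: fsubsetUr.
rewrite (@linextEw _ _ d) ?fsubsetUl // (@linextEw _ x d); last first.
  by apply: fsubset_trans lexy; apply: fsubsetUl.
rewrite (@linextEw _ y d); last by apply: fsubset_trans lexy; apply: fsubsetUr.
rewrite scaler_sumr -big_split /=; apply: eq_bigr => t _.
by rewrite mcoeffD mcoeffZ scalerDl scalerA.
Qed.

End Linext.

Section Quotient.
Variables (K : fieldType) (V W : lmodType K) (S : set V).

Lemma qspan_gen x : S x -> qspan S x.
Proof. by move=> Sx; rewrite -[x]scale1r -[1 *: x]addr0; apply: qspanZD => //; apply: qspan0. Qed.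

Lemma linear_qspan0 (f : V -> W) : linear f ->
  (forall x, S x -> f x = 0) -> forall x, qspan S x -> f x = 0.
Proof.
move=> lf f0 x; elim=> [|c y z Sy _ IH]; first exact: lin0.
by rewrite lf f0 // IH scaler0 addr0.
Qed.

Lemma linear_qspan (f : V -> V) : linear f ->
  (forall x, S x -> qspan S (f x)) -> forall x, qspan S x -> qspan S (f x).
Proof.
move=> lf Sf x; elim=> [|c y z Sy _ IH]; first by rewrite lin0 //; apply: qspan0.
by rewrite lf; apply: qspanD => //; apply: qspanZ; apply: Sf.
Qed.

Lemma qpi_linear : linear (qpi S).
Proof. exact: linearP. Qed.

(** [qrepr] chooses an arbitrary representative, and a linear map that kills the relations cannot
    see the choice. Maps out of a quotient are shown to be well defined in this way. *)
Lemma qdesc (f : V -> W) : linear f ->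
  (forall x, S x -> f x = 0) -> forall x, f (qrepr (qpi S x)) = f x.
Proof.
move=> lf f0 x; apply/eqP; rewrite -subr_eq0 -linB //.
by apply/eqP/(linear_qspan0 lf f0)/qrepr_qpi.
Qed.

Lemma qdesc_linear (f : V -> W) : linear f ->
  (forall x, S x -> f x = 0) -> linear (fun q : quotmod S => f (qrepr q)).
Proof.
move=> lf f0 c p q; rewrite -[p]qreprK -[q]qreprK -qpi_linear !qdesc //.
exact: lf.
Qed.

End Quotient.

(** * Tensor products and tensor products of maps *)

Section TensorProduct.
Variables (K : fieldType) (M N : lmodType K).

Lemma tensDl (m m' : M) (n : N) : tens (m + m') n = tens m n + tens m' n.
Proof.
rewrite /tens -(linD _ _ (@qpi_linear _ _ _)); apply/qpi_eq/qspan_gen.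
exact: tens_Dl.
Qed.

Lemma tensDr (m : M) (n n' : N) : tens m (n + n') = tens m n + tens m n'.
Proof.
rewrite /tens -(linD _ _ (@qpi_linear _ _ _)); apply/qpi_eq/qspan_gen.
exact: tens_Dr.
Qed.

Lemma tensZl c (m : M) (n : N) : tens (c *: m) n = c *: tens m n.
Proof.
rewrite /tens -(linZ _ _ (@qpi_linear _ _ _)); apply/qpi_eq/qspan_gen.
exact: tens_Zl.
Qed.

Lemma tensZr c (m : M) (n : N) : tens m (c *: n) = c *: tens m n.
Proof.
rewrite /tens -(linZ _ _ (@qpi_linear _ _ _)); apply/qpi_eq/qspan_gen.
exact: tens_Zr.
Qed.

Lemma tens_linl (n : N) : linear (fun m : M => tens m n).
Proof. by move=> c m m'; rewrite tensDl tensZl. Qed.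

Lemma tens_linr (m : M) : linear (fun n : N => tens m n).
Proof. by move=> c n n'; rewrite tensDr tensZr. Qed.

Lemma tens0l (n : N) : tens (0 : M) n = 0.
Proof. exact: (lin0 (tens_linl n)). Qed.

(** A scalar can be absorbed into the left factor, so sums of pure tensors already exhaust the
    space. *)
Lemma tens_ind (P : tensmod M N -> Prop) :
  P 0 -> (forall m n t, P t -> P (tens m n + t)) -> forall t, P t.
Proof.
move=> P0 PD t; rewrite -[t]qreprK; elim/malg_ind: (qrepr t) => [|c [m n] x Px].
  by rewrite (lin0 (@qpi_linear _ _ _)).
by rewrite qpi_linear -[qpi _ << _ >>]/(tens m n) -tensZl; apply: PD.
Qed.

End TensorProduct.

Section TensorMap.
Variables (K : fieldType) (M N M' N' : lmodType K) (f : M -> M') (g : N -> N').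
Hypotheses (lf : linear f) (lg : linear g).

Let tmap0 (x : tfree M N) : tens_rel x ->
  linext (fun u : M * N => tens (f u.1) (g u.2)) x = 0.
Proof.
case=> [m m' n|m n n'|c m n|c m n];
  rewrite (linB _ _ (linext_linear _)) ?(linD _ _ (linext_linear _))
          ?(linZ _ _ (linext_linear _)) /tpair !linextU /=.
- by rewrite (linD _ _ lf) tensDl subrr.
- by rewrite (linD _ _ lg) tensDr subrr.
- by rewrite (linZ _ _ lf) tensZl subrr.
- by rewrite (linZ _ _ lg) tensZr subrr.
Qed.

Lemma tmap_tens m n : tmap f g (tens m n) = tens (f m) (g n).
Proof.
rewrite /tmap /tens (qdesc (linext_linear _) tmap0).
by rewrite /tpair linextU.
Qed.

Lemma tmap_linear : linear (tmap f g).
Proof. exact: (qdesc_linear (linext_linear _) tmap0). Qed.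

End TensorMap.

Section MonoidAlgebra.
Variables (K : fieldType) (M : monomType).
Implicit Types (x y : {malg K[M]}) (w v : M).

Lemma malg_scaleU (c : K) w : c *: << w >> = << c *g w >> :> {malg K[M]}.
Proof.
apply/malgP => t; rewrite mcoeffZ !mcoeffU.
by case: eqP; rewrite ?mulr1 ?mulr0.
Qed.

Lemma malg_mulU w v : << w >> * << v >> = << mmul w v >> :> {malg K[M]}.
Proof. by rewrite malgM_def fgmulUU mulr1. Qed.

(** An [lalgType] moves scalars out of the left factor only; moving them out of the right factor
    rests on commutativity of [K] and is checked on monomials. *)
Lemma malg_scaleAr (c : K) x y : x * (c *: y) = c *: (x * y).
Proof.
elim/malg_ind: x => [|d w x IH].
  by rewrite (mul0r (c *: y)) (mul0r y) scaler0.
rewrite (mulrDl (d *: << w >>) x (c *: y)) (mulrDl (d *: << w >>) x y).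
rewrite IH [RHS]scalerDr; congr (_ + _).
rewrite -(scalerAl d << w >> (c *: y)) -(scalerAl d << w >> y).
rewrite [RHS]scalerA (mulrC c d) -[RHS]scalerA; congr (_ *: _).
elim/malg_ind: y {IH} => [|e v y IH]; first by rewrite scaler0 mulr0 scaler0.
rewrite [c *: (_ + _)]scalerDr (mulrDr << w >> (c *: _) (c *: y)) IH.
rewrite (mulrDr << w >> (e *: _) y) [RHS]scalerDr; congr (_ + _).
have wv a : << w >> * (a *: << v >>) = a *: (<< w >> * << v >>) :> {malg K[M]}.
  by rewrite malg_scaleU malg_mulU malg_scaleU malgM_def fgmulUU mul1r.
by rewrite scalerA !wv scalerA.
Qed.

Lemma malg_mulr_linear x : linear (fun y => x * y).
Proof. by move=> c y z; rewrite (mulrDr x (c *: y) z) malg_scaleAr. Qed.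

Lemma malg_mull_linear x : linear (fun y => y * x).
Proof. by move=> c y z; rewrite (mulrDl (c *: y) z x) -(scalerAl c y x). Qed.

Lemma malg_linear_ext (W : lmodType K) (f g : {malg K[M]} -> W) :
  linear f -> linear g -> (forall w, f << w >> = g << w >>) -> f =1 g.
Proof.
move=> lf lg fg; elim/malg_ind => [|c w x IH]; first by rewrite !lin0.
by rewrite lf lg fg IH.
Qed.

(** For multiplicative [s] this is the algebra endomorphism that rescales monomials; with the sign
    of the number of odd letters it is the parity automorphism. *)
Definition twist (s : M -> K) x : {malg K[M]} := linext (fun w => s w *: << w >>) x.

Lemma twist_linear s : linear (twist s).
Proof. exact: linext_linear. Qed.

Lemma twistM s : (forall w v, s (mmul w v) = s w * s v) ->
  forall x y, twist s (x * y) = twist s x * twist s y.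
Proof.
move=> sM x; apply: malg_linear_ext => [||v].
- exact: (lin_comp (malg_mulr_linear x) (twist_linear s)).
- exact: (lin_comp (twist_linear s) (malg_mulr_linear _)).
have lU : linear (fun x => twist s (x * << v >>)).
  exact: (lin_comp (malg_mull_linear << v >>) (twist_linear s)).
have lV : linear (fun x => twist s x * twist s << v >>).
  exact: (lin_comp (twist_linear s) (malg_mull_linear _)).
apply: (malg_linear_ext lU lV _ x) => w; rewrite malg_mulU /twist !linextU sM.
by rewrite malg_scaleAr -(scalerAl _ << w >> << v >>) malg_mulU scalerA mulrC.
Qed.

End MonoidAlgebra.

(** * Quotients by left ideals *)

Section LeftQuotient.
Variables (K : fieldType) (A : lalgType K) (S : set A).
Hypothesis scaleAr : forall c (x y : A), x * (c *: y) = c *: (x * y).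
Hypothesis S_mull : forall a x, S x -> qspan S (a * x).
Implicit Types (a b : A) (m : quotmod S).

Definition lact a m : quotmod S := qpi S (a * qrepr m).

Lemma mulr_linear a : linear (fun x : A => a * x).
Proof. by move=> c x y; rewrite mulrDr scaleAr. Qed.

(** By [S_mull] the span of [S] is a left ideal, so left multiplication does not depend on the
    representative. *)
Lemma lact_qpi a x : lact a (qpi S x) = qpi S (a * x).
Proof.
apply/qpi_eq; rewrite -mulrBr; apply: (linear_qspan (mulr_linear a)).
  exact: S_mull.
exact: qrepr_qpi.
Qed.

Lemma lact_linear a : linear (lact a).
Proof.
move=> c p q; rewrite -[p]qreprK -[q]qreprK -qpi_linear !lact_qpi.
by rewrite -qpi_linear mulr_linear.
Qed.

Lemma lactM a b m : lact (a * b) m = lact a (lact b m).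
Proof. by rewrite -[m]qreprK !lact_qpi mulrA. Qed.

Lemma lactD a b m : lact (a + b) m = lact a m + lact b m.
Proof. by rewrite -[m]qreprK !lact_qpi mulrDl (linD _ _ (@qpi_linear _ _ _)). Qed.

Lemma lactZ c a m : lact (c *: a) m = c *: lact a m.
Proof. by rewrite -[m]qreprK !lact_qpi -scalerAl (linZ _ _ (@qpi_linear _ _ _)). Qed.

Lemma lactN a m : lact (- a) m = - lact a m.
Proof. by rewrite -!scaleN1r lactZ. Qed.

Lemma lactB a b m : lact (a - b) m = lact a m - lact b m.
Proof. by rewrite lactD lactN. Qed.

Lemma lact1 m : lact 1 m = m.
Proof. by rewrite -[m]qreprK lact_qpi mul1r. Qed.

Lemma lact_alg c m : lact c%:A m = c *: m.
Proof. by rewrite lactZ lact1. Qed.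

Lemma lact_eq u v m : (forall b, S ((u - v) * b)) -> lact u m = lact v m.
Proof.
move=> uv; rewrite -[m]qreprK !lact_qpi; apply/qpi_eq/qspan_gen.
by rewrite -mulrBl.
Qed.

Lemma lact_comm x y z m : (forall b, S ((x * y - y * x - z) * b)) ->
  lact x (lact y m) = lact y (lact x m) + lact z m.
Proof. by move/lact_eq => <-; rewrite lactB !lactM addrC subrK. Qed.

Lemma lact_acomm x y z m : (forall b, S ((x * y + y * x - z) * b)) ->
  lact x (lact y m) = - lact y (lact x m) + lact z m.
Proof. by move/lact_eq => <-; rewrite lactD !lactM addrC addrK. Qed.

Lemma lact_ann u : S u -> lact u (qpi S 1) = 0.
Proof.
move=> Su; rewrite lact_qpi mulr1 -(lin0 (@qpi_linear _ _ _)).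
by apply/qpi_eq/qspan_gen; rewrite subr0.
Qed.

Section Twist.
Variable f : A -> A.
Hypotheses (lf : linear f) (fM : {morph f : x y / x * y}).

Lemma morph_scaled a u b e : f u = e *: u ->
  f (a * u * b) = e *: (f a * u * f b).
Proof. by move=> fu; rewrite !fM fu scaleAr -scalerAl. Qed.

Lemma morph_scaledr a u e : f u = e *: u -> f (a * u) = e *: (f a * u).
Proof. by move=> fu; rewrite fM fu scaleAr. Qed.

Lemma morph_eigenM x y d e : f x = d *: x -> f y = e *: y ->
  f (x * y) = (d * e) *: (x * y).
Proof. by move=> fx fy; rewrite fM fx fy scaleAr -scalerAl scalerA mulrC. Qed.

Hypothesis fS : forall x, S x -> qspan S (f x).

Definition qtwist m : quotmod S := qpi S (f (qrepr m)).

(** An endomorphism that maps the left ideal into itself descends to the quotient; this is the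
    source of the parity operator on a cyclic module. *)
Lemma qtwist_qpi x : qtwist (qpi S x) = qpi S (f x).
Proof.
apply/qpi_eq; rewrite -(linB _ _ lf); apply: (linear_qspan lf fS).
exact: qrepr_qpi.
Qed.

Lemma qtwist_linear : linear qtwist.
Proof.
move=> c p q; rewrite -[p]qreprK -[q]qreprK -qpi_linear !qtwist_qpi.
by rewrite -qpi_linear lf.
Qed.

Lemma qtwist_lact a m : qtwist (lact a m) = lact (f a) (qtwist m).
Proof. by rewrite -[m]qreprK lact_qpi !qtwist_qpi lact_qpi fM. Qed.

End Twist.

End LeftQuotient.

Section Cyclic.
Variables (K : fieldType) (X : choiceType).
Local Notation A := (freealg K X).

Lemma freealg_scaleAr c (x y : A) : x * (c *: y) = c *: (x * y).
Proof. exact: malg_scaleAr. Qed.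

Lemma freealg_mulU (w v : {fmonom X}) : << w >> * << v >> = << mmul w v >> :> A.
Proof. exact: malg_mulU. Qed.

Lemma freealg_ind (P : A -> Prop) : P 0 -> P 1 ->
  (forall c x y, P x -> P y -> P (c *: x + y)) ->
  (forall g x, P x -> P (gen K g * x)) -> forall x, P x.
Proof.
move=> P0 P1 PD PM; elim/malg_ind => // c w x Px; apply: PD => //.
case: w => w; elim: w => [|g w IH].
  by have -> : << FMonom [::] >> = 1 :> A; first by rewrite -fmoneE.
suff -> : << FMonom (g :: w) >> = gen K g * << FMonom w >> :> A by apply: PM.
rewrite /gen freealg_mulU; congr << _ >>.
by apply/eqP; rewrite fmP /mmul /= fmuE fmmulE.
Qed.

Section SignMap.
Variable odd : pred X.

Definition signmap : A -> A :=
  twist (fun w : {fmonom X} => (-1) ^+ count odd w : K).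

Lemma signmap_linear : linear signmap. Proof. exact: twist_linear. Qed.

Lemma signmapM : {morph signmap : x y / x * y}.
Proof.
by apply: twistM => w v; rewrite /mmul /= fmmulE count_cat exprD.
Qed.

Lemma signmap_gen g : signmap (gen K g) = (-1) ^+ odd g *: gen K g.
Proof. by rewrite /signmap /gen /twist linextU fmuE /= addn0. Qed.

Lemma signmap1 : signmap 1 = 1.
Proof. by rewrite /signmap /twist [LHS]linextU fm1 scale1r. Qed.

End SignMap.

Variables (rel : A -> A -> Prop) (ann : A -> Prop).
Local Notation C := (cycmod rel ann).
Local Notation vac := (cycvec rel ann).
Implicit Types (a b : A) (m : C).

Lemma cyc_rel_mull a x : cyc_rel rel ann x -> qspan (cyc_rel rel ann) (a * x).
Proof.
case=> [b u v c ruv|b u au].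
  rewrite (mulrA a (b * (u - v)) c) (mulrA a b (u - v)).
  exact/qspan_gen/cyc_of_rel.
by rewrite (mulrA a b u); exact/qspan_gen/cyc_of_ann.
Qed.

Lemma cyc_rel_mulr u v b : rel u v -> cyc_rel rel ann ((u - v) * b).
Proof. by move=> ruv; rewrite -[u - v]mul1r; exact: cyc_of_rel. Qed.

Lemma act_linear a : linear (act a : C -> C).
Proof. exact: (lact_linear freealg_scaleAr cyc_rel_mull). Qed.

Lemma actM a b m : act (a * b) m = act a (act b m).
Proof. exact: (lactM freealg_scaleAr cyc_rel_mull). Qed.

Lemma actD a b m : act (a + b) m = act a m + act b m.
Proof. exact: (lactD freealg_scaleAr cyc_rel_mull). Qed.

Lemma actZ c a m : act (c *: a) m = c *: act a m.
Proof. exact: (lactZ freealg_scaleAr cyc_rel_mull). Qed.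

Lemma actN a m : act (- a) m = - act a m.
Proof. exact: (lactN freealg_scaleAr cyc_rel_mull). Qed.

Lemma actB a b m : act (a - b) m = act a m - act b m.
Proof. exact: (lactB freealg_scaleAr cyc_rel_mull). Qed.

Lemma act1 m : act 1 m = m.
Proof. exact: (lact1 freealg_scaleAr cyc_rel_mull). Qed.

Lemma act0 m : act 0 m = 0.
Proof. by rewrite -[X in act X m](scale0r 0) actZ scale0r. Qed.

Lemma act_alg c m : act c%:A m = c *: m.
Proof. exact: (lact_alg freealg_scaleAr cyc_rel_mull). Qed.

Lemma act_rel u v m : rel u v -> act u m = act v m.
Proof.
move=> ruv; apply: (lact_eq freealg_scaleAr cyc_rel_mull) => b.
exact: cyc_rel_mulr.
Qed.

Lemma act_comm x y z m : rel (comm x y) z ->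
  act x (act y m) = act y (act x m) + act z m.
Proof.
move=> r; apply: (lact_comm freealg_scaleAr cyc_rel_mull) => b.
exact: cyc_rel_mulr.
Qed.

Lemma act_acomm x y z m : rel (acomm x y) z ->
  act x (act y m) = - act y (act x m) + act z m.
Proof.
move=> r; apply: (lact_acomm freealg_scaleAr cyc_rel_mull) => b.
exact: cyc_rel_mulr.
Qed.

Lemma act_ann u : ann u -> act u vac = 0.
Proof.
move=> au; apply: (lact_ann freealg_scaleAr cyc_rel_mull).
by rewrite -[u]mul1r; exact: cyc_of_ann.
Qed.

Lemma cyc_ind (P : C -> Prop) : P vac ->
  (forall c m m', P m -> P m' -> P (c *: m + m')) ->
  (forall g m, P m -> P (act (gen K g) m)) -> forall m, P m.
Proof.
move=> Pv PD PM m; rewrite -[m]qreprK.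
have P0 : P 0 by rewrite -(addNr vac) -scaleN1r; apply: PD.
apply: (freealg_ind (P := fun x => P (qpi _ x))) => [||c x y Px Py|g x Px].
- by rewrite (lin0 (@qpi_linear _ _ _)).
- exact: Pv.
- by rewrite qpi_linear; apply: PD.
- by rewrite -(lact_qpi freealg_scaleAr cyc_rel_mull); apply: PM.
Qed.

Section Grading.
Variable odd : pred X.

(** An eigenvector of the parity automorphism. When all relations and annihilators are of this kind,
    the automorphism preserves the ideal and [grade] is well defined. *)
Definition homogeneous (x : A) := exists e : K, signmap odd x = e *: x.

Hypothesis (rel_hom : forall u v, rel u v -> homogeneous (u - v)).
Hypothesis (ann_hom : forall u, ann u -> homogeneous u).

Let gradeP x : cyc_rel rel ann x -> qspan (cyc_rel rel ann) (signmap odd x).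
Proof.
case=> [a u v b /[dup] ruv /rel_hom[e he]|a u /[dup] au /ann_hom[e he]].
  have -> := morph_scaled freealg_scaleAr (signmapM odd) a b he.
  by apply: qspanZ; exact/qspan_gen/cyc_of_rel.
have -> := morph_scaledr freealg_scaleAr (signmapM odd) a he.
by apply: qspanZ; exact/qspan_gen/cyc_of_ann.
Qed.

Lemma grade_linear : linear (grade odd : C -> C).
Proof. exact: (qtwist_linear (signmap_linear odd) gradeP). Qed.

Lemma grade_vac : grade odd vac = vac.
Proof.
rewrite /cycvec; rewrite -[in RHS](signmap1 odd).
exact: (qtwist_qpi (signmap_linear odd) gradeP).
Qed.

Lemma grade_act g m :
  grade odd (act (gen K g) m) = (-1) ^+ odd g *: act (gen K g) (grade odd m).
Proof.
rewrite -actZ -signmap_gen.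
exact: (qtwist_lact freealg_scaleAr cyc_rel_mull (signmap_linear odd)
  (signmapM odd) gradeP).
Qed.

End Grading.

End Cyclic.

(** * Locally finite fields and normal ordering *)

Section IntSums.
Variables (K : numFieldType) (W : lmodType K).
Implicit Types (F G : int -> W).

Definition zsum F : W := \sum_(m \in [set: int]) F m.

(** Without this condition [zsum F] may be the default value 0, which is not additive in [F]. *)
Definition finz F := exists N : nat, forall m : int, (N <= `|m|)%N -> F m = 0.

Definition zwin (N : nat) : seq int := [seq i%:Z - N%:Z | i <- iota 0 (N + N)].

Lemma zsumE N F : (forall m : int, (N <= `|m|)%N -> F m = 0) ->
  zsum F = \sum_(m <- zwin N) F m.
Proof.
move=> F0; rewrite /zsum (@fsbigE _ _ _ _ _ (zwin N)) => //.
- by apply: eq_bigl => i; rewrite in_setT.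
- by rewrite map_inj_uniq ?iota_uniq // => a b; lia.
- move=> i _ ni; apply: F0; rewrite leqNgt; apply: contra ni => lti.
  apply/mapP; exists (absz (i + N%:Z)); last by lia.
  by rewrite mem_iota; lia.
Qed.

Lemma zsum_ext F G : F =1 G -> zsum F = zsum G.
Proof. by move=> FG; rewrite (_ : F = G) //; apply/funext. Qed.

Lemma zsum0 F : (forall m, F m = 0) -> zsum F = 0.
Proof. by move=> F0; apply: fsbig1. Qed.

Lemma zsum1 a F : (forall m, m <> a -> F m = 0) -> zsum F = F a.
Proof.
move=> F0; rewrite /zsum -(@fsbig_widen _ _ _ _ [set a]) ?fsbig_set1 //.
by move=> i [_ nia]; apply: F0.
Qed.

Lemma zsum_shift c F : zsum (fun m => F (m + c)) = zsum F.
Proof.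
rewrite /zsum [RHS](reindex_fsbigT (fun m : int => m + c)) //.
by exists (fun m => m - c) => m; rewrite ?addrK ?subrK.
Qed.

Lemma finz_window F (a b : int) :
  (forall m, m <= a -> F m = 0) -> (forall m, b <= m -> F m = 0) -> finz F.
Proof.
move=> Fa Fb; exists (`|a| + `|b|)%N => m lem.
by case: (lerP 0 m) => m0; [apply: Fb | apply: Fa]; lia.
Qed.

Lemma finz_ext F G : F =1 G -> finz F -> finz G.
Proof. by move=> FG [N F0]; exists N => m /F0; rewrite FG. Qed.

Lemma finz_lin (V : lmodType K) (f : V -> W) (F : int -> V) : linear f ->
  (exists N : nat, forall m : int, (N <= `|m|)%N -> F m = 0) -> finz (fun m => f (F m)).
Proof. by move=> lf [N F0]; exists N => m /F0 ->; rewrite lin0. Qed.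

Lemma finz_patch (P : pred int) F : finz F -> finz (fun m => if P m then F m else 0).
Proof. by move=> [N F0]; exists N => m /F0 ->; case: ifP. Qed.

Lemma zsumD F G : finz F -> finz G -> zsum (fun m => F m + G m) = zsum F + zsum G.
Proof.
move=> [N F0] [M G0]; pose L := maxn N M.
have [FL GL] : (forall m : int, (L <= `|m|)%N -> F m = 0) /\
    (forall m : int, (L <= `|m|)%N -> G m = 0).
  by split=> m; rewrite geq_max => /andP[le1 le2]; rewrite ?F0 ?G0.
rewrite (zsumE FL) (zsumE GL) -big_split /=.
by apply: zsumE => m le; rewrite FL // GL // addr0.
Qed.

Lemma zsum_mkcond (P : set int) F :
  \sum_(m \in P) F m = zsum (fun m => if m \in P then F m else 0).
Proof. by rewrite fsbig_mkcond. Qed.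

End IntSums.

Section IntSumsLinear.
Variables (K : numFieldType) (V W : lmodType K).

Lemma zsum_lin (f : V -> W) (F : int -> V) : linear f -> finz F ->
  f (zsum F) = zsum (fun m => f (F m)).
Proof.
move=> lf [N F0]; rewrite (zsumE F0) lin_sum // -zsumE // => m /F0 ->.
exact: lin0.
Qed.

End IntSumsLinear.

Section IntSumsFamilies.
Variables (K : numFieldType) (V W : lmodType K).

Lemma zsum_linear (T : int -> V -> W) : (forall m, linear (T m)) ->
  (forall v, finz (fun m => T m v)) -> linear (fun v => zsum (fun m => T m v)).
Proof.
move=> lT fT c u v.
have lc : linear (fun x : W => c *: x) by exact: (lin_scale c (@lin_id _ W)).
rewrite (zsum_lin lc (fT u)) -zsumD //; first by apply: zsum_ext => m; rewrite lT.
exact: (finz_lin lc (fT u)).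
Qed.

(** Exchanging the two summations turns the sum into its own negative, and 2 is invertible. The
    finite square makes the exchange one of finite sums. *)
Lemma zsum_anti (f : int -> int -> W) : (forall p t, f p t = - f t p) ->
  (exists N : nat, forall p t : int,
      (N <= `|p|)%N || (N <= `|t|)%N -> f p t = 0) ->
  zsum (fun p => zsum (f p)) = 0.
Proof.
move=> fN [N f0].
have inner p : zsum (f p) = \sum_(t <- zwin N) f p t.
  by apply: zsumE => t Nt; rewrite f0 // Nt orbT.
have -> : zsum (fun p => zsum (f p)) = \sum_(p <- zwin N) \sum_(t <- zwin N) f p t.
  rewrite (@zsumE _ _ N) => [|p Np]; last by apply: zsum0 => t; rewrite f0 // Np.
  by apply: eq_bigr => p _.
set Z := LHS; have ZN : Z = - Z.
  rewrite {1}/Z exchange_big /= -sumrN; apply: eq_bigr => p _.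
  by rewrite -sumrN; apply: eq_bigr => t _.
have : 2%:R *: Z = 0 by rewrite scaler_nat mulr2n {1}ZN addNr.
by move/eqP; rewrite scaler_eq0 pnatr_eq0 /= => /eqP.
Qed.

End IntSumsFamilies.

Section SmoothFields.
Variables (K : numFieldType) (W : lmodType K).
Implicit Types (A B C : int -> W -> W).

(** The field condition of vertex algebra theory: truncation from above only, with a bound that
    depends on the vector. *)
Definition smooth A := forall w, exists N : int, forall n, N <= n -> A n w = 0.

Definition isfield A := (forall n, linear (A n)) /\ smooth A.

(** The scalar is 1 for commuting and -1 for anticommuting modes, so that even and odd fields share
    their lemmas. *)
Definition exchanges (s : K) A B := forall m n w, A m (B n w) = s *: B n (A m w).

Lemma exchanges_sym s A B : s * s = 1 -> exchanges s A B -> exchanges s B A.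
Proof. by move=> ss ex m n w; rewrite ex scalerA ss scale1r. Qed.

(** Smoothness gives one bound per vector; finitely many vectors admit a common one. *)
Lemma smooth_family A (v : nat -> W) k : smooth A ->
  exists N : int, forall i n, (i < k)%N -> N <= n -> A n (v i) = 0.
Proof.
move=> sA; elim: k => [|k [N IH]]; first by exists 0.
have [M AM] := sA (v k); exists (Num.max N M) => i n.
rewrite ltnS leq_eqVlt ge_max => /orP[/eqP -> /andP[_ le]|lt /andP[le _]].
  exact: AM.
exact: IH.
Qed.

(** Smoothness of [B] bounds [m] from below and, after the exchange, smoothness of [A] bounds it
    from above: such a product is summable even without normal ordering. *)
Lemma exchange_finz s A B n w : isfield A -> isfield B -> exchanges s A B ->
  finz (fun m => A m (B (n - m - 1) w)).
Proof.
move=> [lA sA] [lB sB] ex; have [N AN] := sA w; have [M BM] := sB w.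
apply: (@finz_window _ _ _ (n - 1 - M) N) => m le.
  by rewrite BM ?(lin0 (lA _)) //; lia.
by rewrite ex AN // (lin0 (lB _)) scaler0.
Qed.

End SmoothFields.

Lemma mem_comprehension (T : Type) (P : pred T) x : (x \in [set y | P y]) = P x.
Proof. by apply/idP/idP; rewrite in_setE. Qed.

Section NormalOrder.
Variables (K : numFieldType) (W : lmodType K).
Implicit Types (A B : vfield W).

Local Notation fsign A B := ((-1) ^+ (fodd A && fodd B) : K).

(** The two half-sums of [nop] become one family over all integers, so that each later manipulation
    concerns a single sum. *)
Definition nopterm A B n w (m : int) : W :=
  if m < 0 then mode A m (mode B (n - m - 1) w)
  else fsign A B *: mode B (n - m - 1) (mode A m w).

Lemma nopterm_finz A B n w : isfield (mode A) -> isfield (mode B) ->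
  finz (nopterm A B n w).
Proof.
move=> [lA sA] [lB sB]; have [N AN] := sA w; have [M BM] := sB w.
apply: (@finz_window _ _ _ (Num.min (-1) (n - 1 - M)) (Num.max 0 N)) => m.
  rewrite le_min /nopterm => /andP[m0 mM]; rewrite ifT; last by lia.
  by rewrite BM ?(lin0 (lA _)) //; lia.
rewrite ge_max /nopterm => /andP[m0 mN]; rewrite ifF; last by lia.
by rewrite AN // (lin0 (lB _)) scaler0.
Qed.

Lemma nopE A B n w : isfield (mode A) -> isfield (mode B) ->
  mode (nop A B) n w = zsum (nopterm A B n w).
Proof.
move=> fA fB; have ft := nopterm_finz n w fA fB; have [lA sA] := fA.
have [lB sB] := fB; rewrite /= !zsum_mkcond.
set F1 := fun m => if m \in [set m : int | m < 0] then _ else _.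
set F2 := fun m => if m \in [set m : int | 0 <= m] then _ else _.
have F1E m : F1 m = if m < 0 then nopterm A B n w m else 0.
  by rewrite /F1 mem_comprehension /nopterm; case: ifP.
have F2E m : fsign A B *: F2 m = if ~~ (m < 0) then nopterm A B n w m else 0.
  rewrite /F2 mem_comprehension /nopterm leNgt.
  by case: (m < 0) => //=; rewrite scaler0.
have lc : linear (fun x : W => fsign A B *: x).
  exact: (lin_scale _ (@lin_id _ W)).
(* Finiteness is known for the signed family; since the sign squares to 1, it passes to [F2]
   itself. *)
have fF2 : finz F2.
  have sgnK x : fsign A B *: (fsign A B *: x) = x :> W.
    by rewrite scalerA -expr2 sqrr_sign scale1r.
  apply: (@finz_ext _ _ (fun m => fsign A B *: (fsign A B *: F2 m))) => [m|].
    exact: sgnK.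
  by apply: (finz_lin lc); apply: finz_ext (finz_patch _ ft) => m; rewrite F2E.
rewrite (zsum_lin lc fF2) -zsumD.
- by apply: zsum_ext => m; rewrite F1E F2E; case: ifP; rewrite ?addr0 ?add0r.
- by apply: finz_ext (finz_patch (fun m => m < 0) ft) => m; rewrite F1E.
- exact: finz_lin.
Qed.

Lemma nopterm_linear A B n m : isfield (mode A) -> isfield (mode B) ->
  linear (fun w => nopterm A B n w m).
Proof.
move=> [lA _] [lB _]; rewrite /nopterm; case: (m < 0).
  exact: (lin_comp (lB _) (lA _)).
exact: (lin_scale _ (lin_comp (lA _) (lB _))).
Qed.

Lemma nop_field A B : isfield (mode A) -> isfield (mode B) ->
  isfield (mode (nop A B)).
Proof.
move=> fA fB; split=> [n c u v|w].
  have := zsum_linear (fun m => nopterm_linear n m fA fB)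
    (fun v => nopterm_finz n v fA fB).
  by move=> /(_ c u v); rewrite !nopE.
have [[lA sA] [lB sB]] := (fA, fB).
have [N AN] := sA w; have [M BM] := sB w.
(* For 0 <= m < N the inner vector is one of the finitely many [mode A m w], on which [B] needs a
   common bound. *)
have [L BL] := smooth_family (fun i : nat => mode A i%:Z w) `|N|%N sB.
exists (`|N|%:Z + `|M|%:Z + `|L|%:Z) => n le; rewrite nopE //.
apply: zsum0 => m; rewrite /nopterm; case: (ltrP m 0) => m0.
  by rewrite BM ?(lin0 (lA _)) //; lia.
case: (lerP N m) => Nm; first by rewrite AN // (lin0 (lB _)) scaler0.
have -> : m = `|m|%N%:Z by lia.
by rewrite BL ?scaler0 //; lia.
Qed.

Lemma nop_exchange A B n w : isfield (mode A) -> isfield (mode B) ->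
  exchanges (fsign A B) (mode A) (mode B) ->
  mode (nop A B) n w = zsum (fun m => mode A m (mode B (n - m - 1) w)).
Proof.
move=> fA fB ex; rewrite nopE //; apply: zsum_ext => m.
by rewrite /nopterm; case: ifP => // _; rewrite ex.
Qed.

Lemma nop_pass A B (c : W -> W) (a b : K) n w :
  isfield (mode A) -> isfield (mode B) -> linear c ->
  (forall m v, c (mode A m v) = a *: mode A m (c v)) ->
  (forall m v, c (mode B m v) = b *: mode B m (c v)) ->
  c (mode (nop A B) n w) = (a * b) *: mode (nop A B) n (c w).
Proof.
move=> fA fB lc cA cB; have [[lA _] [lB _]] := (fA, fB).
have ls s : linear (fun x : W => s *: x) by exact: (lin_scale s (@lin_id _ W)).
rewrite !nopE // (zsum_lin lc (nopterm_finz _ _ fA fB)).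
rewrite (zsum_lin (ls _) (nopterm_finz _ _ fA fB)); apply: zsum_ext => m.
rewrite /nopterm; case: ifP => _; first by rewrite cA cB (linZ _ _ (lA _)) scalerA.
rewrite (linZ _ _ lc) cB cA (linZ _ _ (lB _)) !scalerA; congr (_ *: _).
by ring.
Qed.

(** The term of index [u] pairs [A_m] with [B_p] where m + p + 1 = u. Only m <= M and p <= N - 1
    survive, so [M + N] is the highest mode and has a single term. *)
Lemma nop_top A B (M N : int) w : isfield (mode A) -> isfield (mode B) ->
  exchanges (fsign A B) (mode A) (mode B) ->
  (forall m, M < m -> mode A m w = 0) -> (forall m, N <= m -> mode B m w = 0) ->
  (forall u, M + N < u -> mode (nop A B) u w = 0) /\
  mode (nop A B) (M + N) w = mode A M (mode B (N - 1) w).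
Proof.
move=> fA fB ex A0 B0; have [[lA _] [lB _]] := (fA, fB).
have AB0 m p : M < m \/ N <= p -> mode A m (mode B p w) = 0.
  case=> le; last by rewrite B0 // (lin0 (lA _)).
  by rewrite ex A0 // (lin0 (lB _)) scaler0.
split=> [u ltu|]; rewrite nop_exchange //.
  by apply: zsum0 => m; apply: AB0; lia.
rewrite (zsum1 (a := M)) => [|m nm]; last by apply: AB0; lia.
by congr (mode A _ (mode B _ w)); lia.
Qed.

(** The variant for factors that do not commute, such as [dF] and a vertex operator. Normal ordering
    puts [A_0] next to [w], where it acts by its eigenvalue; the other terms die on [w]. *)
Lemma nop_top0 A B f w : isfield (mode A) -> isfield (mode B) ->
  fodd A = false -> (forall m, 0 < m -> mode A m w = 0) ->
  mode A 0 w = f *: w -> (forall m, 0 <= m -> mode B m w = 0) ->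
  (forall u, 0 < u -> mode (nop A B) u w = 0) /\
  mode (nop A B) 0 w = f *: mode B (- 1) w.
Proof.
move=> fA fB evA A0 Af B0; have [[lA _] [lB _]] := (fA, fB).
have t0 u m : 0 <= u -> m <> 0 -> nopterm A B u w m = 0.
  move=> u0 nm; rewrite /nopterm; case: ltrP => m0.
    by rewrite B0 ?(lin0 (lA _)) //; lia.
  by rewrite A0 ?(lin0 (lB _)) ?scaler0 //; lia.
have tE u : 0 <= u -> mode (nop A B) u w = f *: mode B (u - 1) w.
  move=> u0; rewrite nopE // (zsum1 (a := 0)) => [|m]; last exact: t0.
  by rewrite /nopterm ltxx evA scale1r Af (linZ _ _ (lB _)) subr0.
split=> [u ltu|]; last by rewrite tE // sub0r.
by rewrite tE ?ltW // B0 ?scaler0 //; lia.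
Qed.

Lemma dfield_field A : isfield (mode A) -> isfield (mode (dfield A)).
Proof.
move=> [lA sA]; split=> [n|w] /=.
  exact: (lin_scale _ (lA _)).
have [N AN] := sA w; exists (N + 1) => n le.
by rewrite AN ?scaler0 //; lia.
Qed.

End NormalOrder.

(** * The fermionic currents *)

Section Currents.
Variables (K : numFieldType) (W : lmodType K).
Variables (G chi H dF Vp Vm : vfield W) (al ep kap : K).

Hypotheses (fG : isfield (mode G)) (fchi : isfield (mode chi))
  (fH : isfield (mode H)) (fdF : isfield (mode dF))
  (fVp : isfield (mode Vp)) (fVm : isfield (mode Vm)).
Hypotheses (oG : fodd G = true) (ochi : fodd chi = true) (oH : fodd H = false)
  (odF : fodd dF = false) (oVp : fodd Vp = false) (oVm : fodd Vm = false).

Hypotheses (chi_chi : exchanges (-1) (mode chi) (mode chi))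
  (G_chi : exchanges (-1) (mode G) (mode chi))
  (H_chi : exchanges 1 (mode H) (mode chi))
  (dF_chi : exchanges 1 (mode dF) (mode chi))
  (Vp_chi : exchanges 1 (mode Vp) (mode chi))
  (Vm_chi : exchanges 1 (mode Vm) (mode chi))
  (Vp_G : exchanges 1 (mode Vp) (mode G))
  (Vm_G : exchanges 1 (mode Vm) (mode G))
  (Vp_H : exchanges 1 (mode Vp) (mode H))
  (Vm_H : exchanges 1 (mode Vm) (mode H))
  (Vp_Vm : exchanges 1 (mode Vp) (mode Vm)).
(** The constant is (k/2)(1/k): the two-point coefficient of -F with itself, up to sign, times the
    exponent of the vertex operator. *)
Hypothesis dF_Vp : forall m s w,
  mode dF m (mode Vp s w) = mode Vp s (mode dF m w) + 2%:R^-1 *: mode Vp (m + s) w.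

Definition curE n w := mode (nop chi Vp) n w.

(** Both currents in one formula: ([al], [ep]) is (1, -1) for F^1 and ((k+1)/2, 1) for F^2, with
    [kap] = k + 1/2 in both cases. The [dF] term and the derivative term change sign together. *)
Definition curF n w :=
  al *: mode (nop G Vm) n w + ep *: mode (nop chi (nop dF Vm)) n w
  - 2%:R^-1 *: mode (nop H (nop chi Vm)) n w
  + (ep * kap) *: mode (nop (dfield chi) Vm) n w.

Let fchiV : isfield (mode (nop chi Vm)). Proof. exact: nop_field. Qed.
Let fdFV : isfield (mode (nop dF Vm)). Proof. exact: nop_field. Qed.
Let fVV : isfield (mode (nop Vp Vm)). Proof. exact: nop_field. Qed.
Let fdchi : isfield (mode (dfield chi)). Proof. exact: dfield_field. Qed.

Lemma curE_linear n : linear (curE n).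
Proof. exact: (nop_field fchi fVp).1. Qed.

Lemma curF_linear n : linear (curF n).
Proof.
apply: lin_add; last exact: (lin_scale _ ((nop_field fdchi fVm).1 n)).
apply: lin_add; last exact: (lin_opp (lin_scale _ ((nop_field fH fchiV).1 n))).
apply: lin_add; first exact: (lin_scale _ ((nop_field fG fVm).1 n)).
exact: (lin_scale _ ((nop_field fchi fdFV).1 n)).
Qed.

Lemma curE_sum n w : curE n w = zsum (fun p => mode chi p (mode Vp (n - p - 1) w)).
Proof.
rewrite /curE nop_exchange // ochi oVp /=.
by apply: exchanges_sym; rewrite ?mulr1.
Qed.

Let chi_dFV m n w :
  mode (nop dF Vm) n (mode chi m w) = mode chi m (mode (nop dF Vm) n w).
Proof.
rewrite (nop_pass (c := mode chi m) (a := 1) (b := 1)) ?mulr1 ?scale1r //.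
- exact: fchi.1.
- by move=> p v; rewrite scale1r dF_chi scale1r.
- by move=> p v; rewrite scale1r Vm_chi scale1r.
Qed.

Let chi_dchi : exchanges (-1) (mode chi) (mode (dfield chi)).
Proof.
move=> m n w /=; rewrite (linZ _ _ (fchi.1 m)) chi_chi !scalerA.
by rewrite mulrN1 mulN1r.
Qed.

(** Each of the four terms has exactly one odd factor, [G] or [chi] (possibly differentiated), and
    this factor anticommutes with [chi]. *)
Lemma curF_chi n p w : curF n (mode chi p w) = - mode chi p (curF n w).
Proof.
have lchi := fchi.1 p; rewrite /curF !(linD _ _ lchi) (linN _ lchi) !(linZ _ _ lchi).
have chiG : exchanges (-1) (mode chi) (mode G).
  by apply: exchanges_sym => //; rewrite mulrNN mulr1.
have pV m v : mode chi p (mode Vm m v) = 1 *: mode Vm m (mode chi p v).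
  by rewrite scale1r Vm_chi scale1r.
have pchiV m v : mode chi p (mode (nop chi Vm) m v) =
    (-1) *: mode (nop chi Vm) m (mode chi p v).
  by rewrite (nop_pass (a := -1) (b := 1) m v fchi fVm lchi) ?mulr1.
rewrite (nop_pass (a := -1) (b := 1) n w fG fVm lchi) //.
rewrite (nop_pass (a := -1) (b := 1) n w fchi fdFV lchi) //; last first.
  by move=> m v; rewrite scale1r chi_dFV.
rewrite (nop_pass (a := 1) (b := -1) n w fH fchiV lchi) //; last first.
  by move=> m v; rewrite scale1r H_chi scale1r.
rewrite (nop_pass (a := -1) (b := 1) n w fdchi fVm lchi) //.
rewrite mulr1 mul1r !scalerA !mulrN1 !scaleNr !opprD !opprK.
by [].
Qed.

(* [dF_q, Vp_s] contributes the modes of [:Vp Vm:]; only the sum [q + s] of the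
   mode numbers enters. *)
Let dFV_Vp q s w : mode (nop dF Vm) q (mode Vp s w) =
  mode Vp s (mode (nop dF Vm) q w) + 2%:R^-1 *: mode (nop Vp Vm) (q + s) w.
Proof.
have [[lVp _] [lVm _]] := (fVp, fVm).
have VV : mode (nop Vp Vm) (q + s) w =
    zsum (fun m => mode Vp (m + s) (mode Vm (q - m - 1) w)).
  rewrite nop_exchange ?oVp ?oVm //= -(zsum_shift s).
  by apply: zsum_ext => m; congr (mode Vp _ (mode Vm _ w)); lia.
have lh : linear (fun x : W => 2%:R^-1 *: x) by exact: (lin_scale _ (@lin_id _ W)).
have fz : finz (fun m => mode Vp (m + s) (mode Vm (q - m - 1) w)).
  have [N f0] := exchange_finz (q + s) w fVp fVm Vp_Vm.
  exists (N + `|s|)%N => m le; have := f0 (m + s).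
  by rewrite (_ : q + s - (m + s) - 1 = q - m - 1); [apply; lia | lia].
rewrite VV (zsum_lin lh fz) !nopE // (zsum_lin (lVp s)); last exact: nopterm_finz.
rewrite -zsumD; first 1 last.
- exact: (finz_lin (lVp s) (nopterm_finz _ _ _ _)).
- exact: (finz_lin lh fz).
apply: zsum_ext => m; rewrite /nopterm odF /= !scale1r; case: ifP => _.
  by rewrite -[mode Vm _ (mode Vp s w)]scale1r -Vp_Vm dF_Vp.
rewrite dF_Vp (linD _ _ (lVm _)) (linZ _ _ (lVm _)) !Vp_Vm !scale1r.
by [].
Qed.

(** What the contraction of [dF] with [Vp] leaves of the term :chi :dF Vm::. *)
Let corr n s w : W :=
  zsum (fun t => mode chi t (mode (nop Vp Vm) (n - t - 1 + s) w)).

Let VV_chi : exchanges 1 (mode (nop Vp Vm)) (mode chi).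
Proof.
move=> m n w; rewrite scale1r.
rewrite (nop_pass (c := mode chi n) (a := 1) (b := 1)) ?mulr1 ?scale1r //.
- exact: fchi.1.
- by move=> p v; rewrite scale1r Vp_chi scale1r.
- by move=> p v; rewrite scale1r Vm_chi scale1r.
Qed.

Let corr_finz n s w :
  finz (fun t => mode chi t (mode (nop Vp Vm) (n - t - 1 + s) w)).
Proof.
apply: finz_ext (exchange_finz (s := 1) (n + s) w fchi fVV _) => [t|].
  by congr (mode chi t (mode _ _ w)); lia.
by apply: exchanges_sym => //; rewrite mulr1.
Qed.

(** Only the term that contains [dF] has a contraction with [Vp]; the other three commute with
    it. *)
Let curF_Vp n s w : curF n (mode Vp s w) =
  mode Vp s (curF n w) + (ep / 2%:R) *: corr n s w.
Proof.
have lV := fVp.1 s; rewrite /curF !(linD _ _ lV) (linN _ lV) !(linZ _ _ lV).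
have pV m v : mode Vp s (mode Vm m v) = 1 *: mode Vm m (mode Vp s v) by [].
have pchiV m v : mode Vp s (mode (nop chi Vm) m v) =
    1 *: mode (nop chi Vm) m (mode Vp s v).
  by rewrite (nop_pass (a := 1) (b := 1) m v fchi fVm lV) ?mulr1.
have pdchi m v : mode Vp s (mode (dfield chi) m v) =
    1 *: mode (dfield chi) m (mode Vp s v).
  by rewrite /= (linZ _ _ lV) Vp_chi !scale1r.
rewrite (nop_pass (a := 1) (b := 1) n w fG fVm lV) //.
rewrite (nop_pass (a := 1) (b := 1) n w fH fchiV lV) //.
rewrite (nop_pass (a := 1) (b := 1) n w fdchi fVm lV) // mulr1 !scale1r.
have exD : exchanges 1 (mode chi) (mode (nop dF Vm)).
  by move=> m p v; rewrite scale1r chi_dFV.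
have sD v : mode (nop chi (nop dF Vm)) n v =
    zsum (fun t => mode chi t (mode (nop dF Vm) (n - t - 1) v)).
  by apply: nop_exchange => //; rewrite [fodd (nop _ _)]/= ochi odF oVm.
have fz v := exchange_finz n v fchi fdFV exD.
have lh : linear (fun x : W => 2%:R^-1 *: x) by exact: (lin_scale _ (@lin_id _ W)).
have -> : mode (nop chi (nop dF Vm)) n (mode Vp s w) =
    mode Vp s (mode (nop chi (nop dF Vm)) n w) + 2%:R^-1 *: corr n s w.
  rewrite !sD (zsum_lin lV (fz _)) /corr (zsum_lin lh (corr_finz _ _ _)) -zsumD.
  - apply: zsum_ext => t; rewrite dFV_Vp (linD _ _ (fchi.1 t)) (linZ _ _ (fchi.1 t)).
    by rewrite Vp_chi scale1r.
  - exact: (finz_lin lV (fz _)).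
  - exact: (finz_lin lh (corr_finz _ _ _)).
rewrite (scalerDr ep) scalerA -!addrA; congr (_ + (_ + _)).
by rewrite addrC -!addrA.
Qed.

Lemma curF_curE n m w : curF n (curE m w) = - curE m (curF n w).
Proof.
have exV : exchanges 1 (mode chi) (mode Vp) by apply: exchanges_sym => //; rewrite mulr1.
have fz v := exchange_finz m v fchi fVp exV.
have lF := curF_linear n; have lchi p := fchi.1 p.
have lN : linear (fun x : W => - x) by exact: (lin_opp (@lin_id _ W)).
have lNh : linear (fun x : W => - (ep / 2%:R) *: x).
  exact: (lin_scale _ (@lin_id _ W)).
pose f p t := mode chi p (mode chi t (mode (nop Vp Vm) (n - t - 1 + (m - p - 1)) w)).
have corrE p : mode chi p (corr n (m - p - 1) w) = zsum (f p).
  by rewrite (zsum_lin (lchi p) (corr_finz _ _ _)).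
have termE p : curF n (mode chi p (mode Vp (m - p - 1) w)) =
    - mode chi p (mode Vp (m - p - 1) (curF n w)) + - (ep / 2%:R) *: zsum (f p).
  rewrite curF_chi curF_Vp (linD _ _ (lchi p)) (linZ _ _ (lchi p)) corrE.
  by rewrite opprD scaleNr.
(* If p or t is at least T, some [chi] can be moved onto [w] and kills it. Otherwise both are
   bounded above, so a large absolute value makes p + t very negative, and the mode of :Vp Vm: is
   high enough to kill [w]. *)
have box : exists N : nat, forall p t : int,
    (N <= `|p|)%N || (N <= `|t|)%N -> f p t = 0.
  have [U VU] := fVV.2 w; have [T chiT] := fchi.2 w.
  have ft p t : T <= t -> f p t = 0.
    move=> le; rewrite /f -[mode chi t _]scale1r -VV_chi chiT //.
    by rewrite !(lin0 (lchi _), lin0 (fVV.1 _)).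
  have fp p t : T <= p -> f p t = 0.
    move=> le; rewrite /f chi_chi -[mode chi p _]scale1r -VV_chi chiT //.
    by rewrite !(lin0 (lchi _), lin0 (fVV.1 _)) scaler0.
  have fU p t : t + p <= n + m - 2 - U -> f p t = 0.
    by move=> le; rewrite /f VU ?(lin0 (lchi _)) //; lia.
  exists (`|T| + `|n| + `|m| + `|U| + 2 + `|T|)%N => p t lpt.
  case: (lerP T t) => Tt; first exact: ft.
  case: (lerP T p) => Tp; first exact: fp.
  by apply: fU; lia.
have Z0 : zsum (fun p => zsum (f p)) = 0.
  apply: zsum_anti box => p t; rewrite /f chi_chi scaleN1r; congr (- _).
  by congr (mode chi _ (mode chi _ (mode _ _ w))); lia.
have fzf : finz (fun p => zsum (f p)).
  by have [N f0] := box; exists N => p Np; apply: zsum0 => t; rewrite f0 // Np.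
rewrite curE_sum (zsum_lin lF (fz w)) (zsum_ext termE) zsumD; first 1 last.
- exact: (finz_lin lN (fz _)).
- exact: (finz_lin lNh fzf).
by rewrite -(zsum_lin lNh fzf) Z0 scaler0 addr0 -(zsum_lin lN (fz _)) -curE_sum.
Qed.

Section TopStates.
Variables (w w' : W) (n : nat).
Hypotheses (chi0 : forall p : int, - n%:Z <= p -> mode chi p w = 0).

Lemma curE_top : (forall s, 0 <= s -> mode Vp s w = 0) -> mode Vp (- 1) w = w' ->
  curE (- n.+1%:Z) w = mode chi (- n.+1%:Z) w'.
Proof.
clear oG oH odF oVm; move=> V0 V1; rewrite /curE -[X in mode _ X w]addr0.
have [|//|//|_ ->] := nop_top (M := - n.+1%:Z) (N := 0) (w := w) fchi fVp.
- by rewrite ochi oVp; apply: exchanges_sym; rewrite ?mulr1.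
- by move=> m lt; apply: chi0; lia.
by rewrite sub0r V1.
Qed.

Variables (s : nat) (f eta : K).
Hypotheses (V0 : forall m, 0 <= m -> mode Vm m w = 0) (V1 : mode Vm (- 1) w = w').
Hypotheses (dF0 : forall m, 0 < m -> mode dF m w = 0) (dFw : mode dF 0 w = f *: w).
Hypotheses (H0 : forall m, 0 < m -> mode H m w = 0) (Hw : mode H 0 w = eta *: w).
Hypothesis G0 : forall m : int, - s%:Z < m -> mode G m w = 0.
Hypothesis sn : (s < n)%N \/
  s = n /\ ep * f - eta / 2%:R + ep * kap * n%:R = 0.

(** On [w] the three terms with [chi] vanish in all modes above -n, which settles s < n. In mode -n
    each is a multiple of [chi_(-n-1) w']: the [dF] term gives [ep] f, the [H] term gives -eta/2,
    and the derivative gives [ep kap] n because its mode -n is n times [chi_(-n-1)]. The hypothesis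
    [sn] says that these add up to 0. *)
Lemma curF_top : curF (- s%:Z) w = al *: mode G (- s%:Z) w'.
Proof.
clear oVp; have exs A B : exchanges 1 A B -> exchanges (W := W) 1 B A.
  by apply: exchanges_sym; rewrite mulr1.
have GVE : mode (nop G Vm) (- s%:Z) w = mode G (- s%:Z) w'.
  rewrite -[X in mode _ X w]addr0.
  have [|//|//|_ ->] := nop_top (M := - s%:Z) (N := 0) (w := w) fG fVm.
    by rewrite oG oVm; apply: exs.
  by rewrite sub0r V1.
have [D0 DE] := nop_top0 fdF fVm odF dF0 dFw V0.
have exD : exchanges ((-1) ^+ (fodd chi && fodd (nop dF Vm)))
    (mode chi) (mode (nop dF Vm)).
  rewrite [fodd (nop _ _)]/= odF oVm andbF => m p v.
  by rewrite scale1r chi_dFV.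
have [||cD0] := nop_top (M := - n.+1%:Z) (N := 1) (w := w) fchi fdFV exD.
- by move=> m lt; apply: chi0; lia.
- by move=> m lt; apply: D0; lia.
rewrite subrr DE V1 => cDE.
have exV : exchanges ((-1) ^+ (fodd chi && fodd Vm)) (mode chi) (mode Vm).
  by rewrite ochi oVm; apply: exs.
have [||cV0] := nop_top (M := - n.+1%:Z) (N := 0) (w := w) fchi fVm exV.
- by move=> m lt; apply: chi0; lia.
- exact: V0.
rewrite sub0r V1 => cVE.
have exH : exchanges ((-1) ^+ (fodd H && fodd (nop chi Vm)))
    (mode H) (mode (nop chi Vm)).
  rewrite [fodd (nop _ _)]/= oH ochi oVm => m p v.
  rewrite (nop_pass (a := 1) (b := 1) p v fchi fVm (fH.1 m)) ?mulr1 // => q u.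
  by rewrite scale1r Vm_H scale1r.
have [|cH0] := nop_top (M := 0) (N := - n%:Z) (w := w) fH fchiV exH H0.
- by move=> m le; apply: cV0; lia.
have -> : - n%:Z - 1 = - n.+1%:Z + 0 by lia.
rewrite cVE add0r => cHE.
have exd : exchanges ((-1) ^+ (fodd (dfield chi) && fodd Vm))
    (mode (dfield chi)) (mode Vm).
  rewrite /= ochi oVm => m p v /=.
  by rewrite scale1r (linZ _ _ (fVm.1 _)) Vm_chi scale1r.
have [||cd0] := nop_top (M := - n%:Z) (N := 0) (w := w) fdchi fVm exd.
- by move=> m lt; rewrite /= chi0 ?scaler0 //; lia.
- exact: V0.
rewrite sub0r V1 => cdE.
rewrite /curF GVE; case: sn => [lt|[-> co]].
  rewrite cD0 ?cH0 ?cd0; [|lia..].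
  by rewrite !scaler0 subr0 !addr0.
rewrite -[in X in ep *: X](_ : - n.+1%:Z + 1 = - n%:Z); last lia.
rewrite cDE -{3}[- n%:Z]addr0 cdE cHE.
have -> : mode H 0 (mode chi (- n.+1%:Z) w') = eta *: mode chi (- n.+1%:Z) w'.
  by rewrite H_chi -V1 -[mode H 0 _]scale1r -Vm_H Hw (linZ _ _ (fVm.1 _))
             (linZ _ _ (fchi.1 _)) scale1r.
rewrite /= (_ : - n%:Z - 1 = - n.+1%:Z); last lia.
rewrite (linZ _ _ (fchi.1 _)) !scalerA -!addrA -scaleNr -!scalerDl.
rewrite [X in _ + X *: _](_ : _ = 0) ?scale0r ?addr0 // -[RHS]co.
by rewrite mulrNz opprK -[n%:~R]/(n%:R : K); ring.
Qed.

End TopStates.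

End Currents.

(** * Vertex operators *)

Section ExpSeriesTheory.
Variables (K : numFieldType) (W : lmodType K) (t : nat -> W -> W).
Hypothesis lt : forall i, linear (t i).

Lemma serpow_linear s m : linear (serpow t s m).
Proof.
elim: s m => [|s IH] m /=.
  by case: (m == 0)%N; [exact: lin_id | exact: lin_zero].
by apply: lin_bigsum => i _; exact: (lin_comp (IH _) (lt _)).
Qed.

Lemma expser_linear m : linear (expser t m).
Proof. by apply: lin_bigsum => s _; exact: (lin_scale _ (serpow_linear s m)). Qed.

Lemma serpow_gt s m w : (m < s)%N -> serpow t s m w = 0.
Proof.
elim: s m => [|s IH] m //= ms; apply: big1 => i _.
by rewrite IH ?(lin0 (lt _)) //; have := ltn_ord i; lia.
Qed.

Lemma expser0 w : expser t 0 w = w.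
Proof. by rewrite /expser big_ord1 /= fact0 invr1 scale1r. Qed.

Lemma expser_vac m w : (forall i, (0 < i)%N -> t i w = 0) -> (0 < m)%N ->
  expser t m w = 0.
Proof.
move=> t0 m0; have sp0 s n : serpow t s.+1 n w = 0.
  elim: s n => [|s IH] n /=; apply: big1 => i _.
    by case: ifP => _; [exact: t0 | exact: (lin0 (lt _))].
  by rewrite -[X in t _ X]/(serpow t s.+1 (n - i.+1) w) IH (lin0 (lt _)).
rewrite /expser big1 // => [[[|s] lts]] _ /=; last first.
  by rewrite -[X in _ *: X]/(serpow t s.+1 m w) sp0 scaler0.
by rewrite gtn_eqF // scaler0.
Qed.

(** With T(z) the series of the [t_n], the commutator [D, T(z)] is the scalar c z^i0, hence [D, T^s]
    = s c z^i0 T^(s-1). At s = 0 the truncated [s.-1] is harmless, as its coefficient vanishes. *)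
Lemma serpow_deriv (D : W -> W) i0 c s m w : linear D -> (0 < i0)%N ->
  (forall i v, (0 < i)%N -> D (t i v) = t i (D v) + (if i == i0 then c else 0) *: v) ->
  D (serpow t s m w) = serpow t s m (D w) +
    (if (i0 <= m)%N then (s%:R * c) *: serpow t s.-1 (m - i0) w else 0).
Proof.
move=> lD i00 Dt; elim: s m => [|s IH] m /=.
  by rewrite mul0r scale0r; case: (m == 0)%N; case: ifP; rewrite ?(lin0 lD) addr0.
rewrite (lin_sum _ _ _ lD).
have DE (i : 'I_m) : D (t i.+1 (serpow t s (m - i.+1) w)) =
    t i.+1 (serpow t s (m - i.+1) (D w)) +
    (t i.+1 (if (i0 <= m - i.+1)%N then
       (s%:R * c) *: serpow t s.-1 (m - i.+1 - i0) w else 0) +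
     (if i.+1 == i0 then c else 0) *: serpow t s (m - i.+1) w).
  by rewrite Dt // IH (linD _ _ (lt _)) -addrA.
rewrite (eq_bigr _ (fun i _ => DE i)) big_split /=; congr (_ + _); case: leqP => [le|ltm]; last first.
  apply: big1 => i _; have im := ltn_ord i.
  rewrite ifF; last by apply/negbTE; rewrite -ltnNge; lia.
  rewrite (lin0 (lt _)) add0r [_ == i0]ltn_eqF ?scale0r //; lia.
rewrite big_split /= addrC -[in RHS]natr1 mulrDl mul1r scalerDl [RHS]addrC.
have li : (i0.-1 < m)%N by lia.
congr (_ + _).
  rewrite (bigD1 (Ordinal li)) //= prednK // eqxx big1 ?addr0 // => i ni.
  rewrite [_ == i0](_ : _ = false) ?scale0r //.
  by apply: contraNF ni => /eqP E; apply/eqP/val_inj => /=; rewrite -E.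
case: s IH {DE} => [|s] IH.
  rewrite mul0r scale0r; apply: big1 => i _ /=.
  by rewrite scale0r if_same (lin0 (lt _)).
rewrite scaler_sumr -(big_mkord xpredT (fun i => t i.+1 (if (i0 <= m - i.+1)%N
   then (s.+1%:R * c) *: serpow t s (m - i.+1 - i0) w else 0))).
(* From index m - i0 on, the remaining degree is below i0 and the contribution is the zero
   branch. *)
rewrite (@big_cat_nat _ _ _ (m - i0)) ?leq_subr //=.
rewrite [X in _ + X]big_nat_cond [X in _ + X]big1 ?addr0 => [|i].
  rewrite big_mkord; apply: eq_bigr => i _; have im := ltn_ord i.
  rewrite ifT; last by lia.
  by rewrite (linZ _ _ (lt _)) (_ : (m - i.+1 - i0 = m - i0 - i.+1)%N); last lia.
move=> /andP[/andP[h1 h2] _]; rewrite ifF ?(lin0 (lt _)) //.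
by apply/negbTE; rewrite -ltnNge; lia.
Qed.

(** The exponential form of the preceding rule: [D, exp T] = c z^i0 exp T, the factor s being
    absorbed by the factorial. *)
Lemma expser_deriv (D : W -> W) i0 c m w : linear D -> (0 < i0)%N ->
  (forall i v, (0 < i)%N -> D (t i v) = t i (D v) + (if i == i0 then c else 0) *: v) ->
  D (expser t m w) = expser t m (D w) +
    (if (i0 <= m)%N then c *: expser t (m - i0) w else 0).
Proof.
move=> lD i00 Dt; rewrite /expser (lin_sum _ _ _ lD).
under eq_bigr => s _ do rewrite (linZ _ _ lD) (serpow_deriv _ _ _ lD i00 Dt) scalerDr.
rewrite big_split /=; congr (_ + _); case: leqP => [le|_]; last first.
  by apply: big1 => s _; rewrite scaler0.
rewrite big_ord_recl /= mul0r scale0r scaler0 add0r scaler_sumr.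
rewrite -(big_mkord xpredT (fun s => (s.+1`!%:R)^-1 *:
   ((s.+1%:R * c) *: serpow t s (m - i0) w))).
(* [expser] is cut off at the degree, which differs on the two sides. The extra powers vanish
   because T starts in degree 1. *)
rewrite (@big_cat_nat _ _ _ (m - i0).+1) ?leq_subr //=; last by lia.
rewrite [X in _ + X]big_nat_cond [X in _ + X]big1 ?addr0 => [|s].
  rewrite big_mkord; apply: eq_bigr => s _; rewrite !scalerA; congr (_ *: _).
  by rewrite factS natrM invfM mulrACA mulVf ?pnatr_eq0 // mul1r mulrC.
by move=> /andP[/andP[h1 h2] _]; rewrite serpow_gt // !scaler0.
Qed.

Lemma expser_comm (D : W -> W) m w : linear D ->
  (forall i v, (0 < i)%N -> D (t i v) = t i (D v)) ->
  D (expser t m w) = expser t m (D w).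
Proof.
(* The index 1 is arbitrary here, since the commutator is 0. *)
move=> lD Dt; rewrite (expser_deriv (i0 := 1) (c := 0) m w lD) //.
  by rewrite scale0r if_same addr0.
by move=> i v i0; rewrite Dt // if_same scale0r addr0.
Qed.

End ExpSeriesTheory.

(* The operators on [bfock k] are kept abstract: it spares the unifier from
   unfolding the quotient construction. *)
Section HeisenbergModule.
Variables (K : numFieldType) (k : K) (B : lmodType K).
Variables (F U : int -> B -> B) (S : K -> B -> B) (vac : B).
Local Notation delta m := (((m : int) == 0)%:R : K).

Hypotheses (opF_linear : forall n, linear (F n))
  (opU_linear : forall n, linear (U n)) (opS_linear : forall b, linear (S b)).
Hypothesis opFF : forall m n w,
  F m (F n w) = F n (F m w) + (- (k / 2%:R) * m%:~R * delta (m + n)) *: w.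
Hypothesis opUU : forall m n w,
  U m (U n w) = U n (U m w) + (k / 2%:R * m%:~R * delta (m + n)) *: w.
Hypothesis opFU : forall m n w, F m (U n w) = U n (F m w).
Hypothesis opFS : forall m b w,
  F m (S b w) = S b (F m w) + (k * b / 2%:R * delta m) *: S b w.
Hypothesis opUS : forall m b w,
  U m (S b w) = S b (U m w) + (k * b / 2%:R * delta m) *: S b w.
Hypothesis opSS : forall a b w, S a (S b w) = S (a + b) w.
Hypothesis opS0 : forall w, S 0 w = w.
Hypotheses (opF_cycvec : forall n, 0 <= n -> F n vac = 0)
  (opU_cycvec : forall n, 0 <= n -> U n vac = 0).
Hypothesis module_ind : forall P : B -> Prop, P vac ->
  (forall c w w', P w -> P w' -> P (c *: w + w')) ->
  (forall n w, P w -> P (F n w)) -> (forall n w, P w -> P (U n w)) ->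
  (forall b w, P w -> P (S b w)) -> forall w, P w.

Definition heisX n w := U n w - F n w.
Local Notation X := heisX.

Lemma opUF_linear n : linear (X n).
Proof. exact: (lin_add (opU_linear n) (lin_opp (opF_linear n))). Qed.

Lemma opSC a b w : S a (S b w) = S b (S a w).
Proof. by rewrite !opSS addrC. Qed.

(** F and U have opposite levels and X = U - F, so F and U have the same commutator with X. This
    makes X commute with itself, and one derivation argument serves both bosons. *)
Lemma opFX m n w : F m (X n w) = X n (F m w) + (k / 2%:R * m%:~R * delta (m + n)) *: w.
Proof.
rewrite /heisX (linB _ _ (opF_linear m)) opFU opFF opprD addrA.
by rewrite -scaleNr !mulNr opprK.
Qed.

Lemma opUX m n w : U m (X n w) = X n (U m w) + (k / 2%:R * m%:~R * delta (m + n)) *: w.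
Proof. by rewrite /heisX (linB _ _ (opU_linear m)) opUU -opFU addrAC. Qed.

Lemma opSX b n w : S b (X n w) = X n (S b w).
Proof. by rewrite /heisX (linB _ _ (opS_linear b)) opFS opUS opprD addrACA subrr addr0. Qed.

Lemma opUF_vac a n : 0 <= n -> X n (S a vac) = 0.
Proof.
move=> n0; rewrite  -opSX /heisX opU_cycvec // opF_cycvec //.
by rewrite subrr (lin0 (opS_linear a)).
Qed.

Lemma opF_vac a n : 0 < n -> F n (S a vac) = 0.
Proof.
move=> n0; rewrite  opFS gt_eqF // mulr0 scale0r addr0.
by rewrite opF_cycvec ?ltW // (lin0 (opS_linear a)).
Qed.

Lemma opF0_vac a : F 0 (S a vac) = (k * a / 2%:R) *: S a vac.
Proof. by rewrite  opFS eqxx mulr1 opF_cycvec // (lin0 (opS_linear a)) add0r. Qed.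

Section Halves.
Variable b : K.

(* The two exponentials of the vertex operator, with their modes indexed by [int]
   and extended by zero. *)
Definition tminus (i : nat) (v : B) : B := (b / i%:R) *: X (- (i : int)) v.
Definition tplus (i : nat) (v : B) : B := - (b / i%:R) *: X i v.
Definition expminus (p : int) (w : B) : B :=
  if 0 <= p then expser tminus `|p|%N w else 0.
Definition expplus (q : int) (w : B) : B :=
  if 0 <= q then expser tplus `|q|%N w else 0.

Lemma tminus_linear i : linear (tminus i).
Proof. exact: (lin_scale _ (opUF_linear _)). Qed.
Lemma tplus_linear i : linear (tplus i).
Proof. exact: (lin_scale _ (opUF_linear _)). Qed.

Lemma expminus_linear p : linear (expminus p).
Proof.
rewrite /expminus; case: (0 <= p); last exact: lin_zero.
exact: expser_linear tminus_linear _.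
Qed.

Lemma expplus_linear p : linear (expplus p).
Proof.
rewrite /expplus; case: (0 <= p); last exact: lin_zero.
exact: expser_linear tplus_linear _.
Qed.

Lemma exp_comm (D : B -> B) p w : linear D -> (forall n v, D (X n v) = X n (D v)) ->
  D (expminus p w) = expminus p (D w) /\ D (expplus p w) = expplus p (D w).
Proof.
move=> lD DX; rewrite /expminus /expplus; case: (0 <= p); last by rewrite !(lin0 lD).
split.
  apply: (expser_comm tminus_linear) => // i v _.
  by rewrite /tminus (linZ _ _ lD) DX.
apply: (expser_comm tplus_linear) => // i v _.
by rewrite /tplus (linZ _ _ lD) DX.
Qed.

Section Derivation.
Variables (g : int -> B -> B).
Hypothesis lg : forall m, linear (g m).
Hypothesis gX : forall m n w,
  g m (X n w) = X n (g m w) + (k / 2%:R * m%:~R * delta (m + n)) *: w.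

Lemma expminus_deriv m p w : g m (expminus p w) = expminus p (g m w) +
  (if 0 < m then (k * b / 2%:R) *: expminus (p - m) w else 0).
Proof.
rewrite /expminus; case: (lerP 0 p) => p0; last first.
  rewrite (lin0 (lg m)) add0r; case: (ltrP 0 m) => // m0.
  by rewrite ifF ?scaler0 //; lia.
case: (ltrP 0 m) => m0.
  (* The coefficient b/i in the exponent meets (k/2) m at i = m, which leaves kb/2. *)
  rewrite (expser_deriv tminus_linear (i0 := `|m|%N) (c := k * b / 2%:R)) //; last first.
  - move=> i v i0; rewrite /tminus (linZ _ _ (lg m)) gX scalerDr scalerA; congr (_ + _ *: _).
    rewrite (_ : (m - i%:Z == 0) = (i == `|m|%N)); last by lia.
    case: eqP => [E|_]; last by rewrite !mulr0.
    have -> : m = i%:Z by lia.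
    have iN : i%:R != 0 :> K by rewrite pnatr_eq0 -lt0n.
    by rewrite mulr1 -[i%:~R]/(i%:R : K); field.
  - by lia.
  congr (_ + _); rewrite (_ : (`|m| <= `|p|)%N = (0 <= p - m)); last by lia.
  case: ifP => // le; last by rewrite scaler0.
  by congr (_ *: expser _ _ _); lia.
rewrite addr0; apply: (expser_comm tminus_linear) => // i v i0.
rewrite /tminus (linZ _ _ (lg m)) gX (_ : (m - i%:Z == 0) = false); last by lia.
by rewrite mulr0 scale0r addr0.
Qed.

Lemma expplus_deriv m p w : g m (expplus p w) = expplus p (g m w) +
  (if m < 0 then (k * b / 2%:R) *: expplus (p + m) w else 0).
Proof.
rewrite /expplus; case: (lerP 0 p) => p0; last first.
  rewrite (lin0 (lg m)) add0r; case: (ltrP m 0) => // m0.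
  by rewrite ifF ?scaler0 //; lia.
case: (ltrP m 0) => m0.
  (* Here m = -i, and its sign cancels the minus sign of the exponent: again kb/2. *)
  rewrite (expser_deriv tplus_linear (i0 := `|m|%N) (c := k * b / 2%:R)) //; last first.
  - move=> i v i0; rewrite /tplus (linZ _ _ (lg m)) gX scalerDr scalerA; congr (_ + _ *: _).
    rewrite (_ : (m + i%:Z == 0) = (i == `|m|%N)); last by lia.
    case: eqP => [E|_]; last by rewrite !mulr0.
    have -> : m = - i%:Z by lia.
    have iN : i%:R != 0 :> K by rewrite pnatr_eq0 -lt0n.
    by rewrite mulr1 mulrNz -[i%:~R]/(i%:R : K); field.
  - by lia.
  congr (_ + _); rewrite (_ : (`|m| <= `|p|)%N = (0 <= p + m)); last by lia.
  case: ifP => // le; last by rewrite scaler0.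
  by congr (_ *: expser _ _ _); lia.
rewrite addr0; apply: (expser_comm tplus_linear) => // i v i0.
rewrite /tplus (linZ _ _ (lg m)) gX (_ : (m + i%:Z == 0) = false); last by lia.
by rewrite mulr0 scale0r addr0.
Qed.

End Derivation.

Lemma expplus_vac a q : 0 < q -> expplus q (S a vac) = 0.
Proof.
move=> q0; rewrite /expplus ifT ?ltW //; apply: (expser_vac tplus_linear); last by lia.
by move=> i i0; rewrite /tplus opUF_vac ?scaler0.
Qed.

(** The annihilating exponential is polynomial on each state. It is 1 on the vacuum, and applying a
    mode of index m to a state raises the degree by at most |m|, by the commutation rule of
    [expplus_deriv]. *)
Lemma expplus_smooth w : exists N : int, forall q, N <= q -> expplus q w = 0.
Proof.
have D g : (forall m, linear (g m)) -> (forall m n w,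
    g m (X n w) = X n (g m w) + (k / 2%:R * m%:~R * delta (m + n)) *: w) ->
    forall m v, (exists N : int, forall q, N <= q -> expplus q v = 0) ->
    exists N : int, forall q, N <= q -> expplus q (g m v) = 0.
  move=> lg gX m v [N v0]; exists (N + `|m|%:Z) => q le.
  have := expplus_deriv lg gX m q v; rewrite v0 ?(lin0 (lg m)); last by lia.
  rewrite v0; last by lia.
  by rewrite scaler0 if_same addr0 => <-.
elim/module_ind: w => [|c v v' [N v0] [M v0']|n v|n v|a v [N v0]].
- by exists 1 => q le; rewrite -(opS0 vac) expplus_vac //; lia.
- exists (Num.max N M) => q; rewrite ge_max => /andP[le le'].
  by rewrite expplus_linear v0 // v0' // scaler0 addr0.
- exact: (D F opF_linear opFX).
- exact: (D U opU_linear opUX).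
- exists N => q le.
  by rewrite -(exp_comm q v (opS_linear a) (opSX a)).2 v0 // (lin0 (opS_linear a)).
Qed.

Definition vopterm n w (q : int) := expminus (q - n - 1) (S b (expplus q w)).

Lemma vopterm_linear n q : linear (fun w => vopterm n w q).
Proof.
have l1 := lin_comp (expplus_linear q) (opS_linear b).
exact: (lin_comp l1 (expminus_linear _)).
Qed.

Lemma vopterm_finz n w : finz (vopterm n w).
Proof.
have [N w0] := expplus_smooth w.
apply: (@finz_window _ _ _ (-1) N) => q le.
  rewrite /vopterm /expplus ifF; last by lia.
  by rewrite (lin0 (opS_linear b)) (lin0 (expminus_linear _)).
by rewrite /vopterm w0 // (lin0 (opS_linear b)) (lin0 (expminus_linear _)).
Qed.

Definition heis_vop n w : B :=
  \sum_(pq \in [set pq : nat * nat | (pq.1 : int) - (pq.2 : int) = - n - 1])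
    expser tminus pq.1 (S b (expser tplus pq.2 w)).

(** The difference of the two degrees is fixed, so the pairs are parametrized by the second degree
    q; extension by zero then lets q run over all integers. *)
Lemma vopE n w : heis_vop n w = zsum (vopterm n w).
Proof.
rewrite /heis_vop (@reindex_fsbig _ _ _ _ _ (fun q : int => (absz (q - n - 1)%R, absz q))
   [set q : int | (0 <= q) && (0 <= q - n - 1)]); last first.
  split=> [q /= /andP[q0 q1]|x y|[p q] /= E]; first by lia.
    by rewrite !in_setE /= => /andP[x0 x1] /andP[y0 y1] [_]; lia.
  by exists q%:Z => /=; [lia | congr (_, _); lia].
rewrite zsum_mkcond; apply: zsum_ext => q; rewrite mem_comprehension.
rewrite /vopterm /expminus /expplus; case: (0 <= q) => /=; first by [].
by case: ifP => // _; rewrite (lin0 (opS_linear b)) (lin0 (expser_linear tminus_linear _)).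
Qed.

Lemma vop_field : isfield heis_vop.
Proof.
split=> [n c u v|w].
  by rewrite !vopE; exact: (zsum_linear (vopterm_linear n) (vopterm_finz n)).
have [N w0] := expplus_smooth w; exists N => n le; rewrite vopE.
apply: zsum0 => q; rewrite /vopterm; case: (lerP N q) => Nq.
  by rewrite w0 // (lin0 (opS_linear b)) (lin0 (expminus_linear _)).
by rewrite /expminus ifF //; lia.
Qed.

Lemma vop_pass (D : B -> B) n w : linear D -> (forall n v, D (X n v) = X n (D v)) ->
  (forall v, D (S b v) = S b (D v)) -> D (heis_vop n w) = heis_vop n (D w).
Proof.
move=> lD DX DS; rewrite !vopE (zsum_lin lD (vopterm_finz _ _)).
apply: zsum_ext => q; rewrite /vopterm (exp_comm _ _ lD DX).1 DS.
by rewrite (exp_comm _ _ lD DX).2.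
Qed.

(** For m > 0 the extra term comes from the creating exponential, for m < 0 from the annihilating
    one, for m = 0 from the translation [S b]; each gives the same constant kb/2. *)
Lemma vop_deriv (g : int -> B -> B) m n w : (forall m, linear (g m)) ->
  (forall m n w, g m (X n w) = X n (g m w) + (k / 2%:R * m%:~R * delta (m + n)) *: w) ->
  (forall m w, g m (S b w) = S b (g m w) + (k * b / 2%:R * delta m) *: S b w) ->
  g m (heis_vop n w) = heis_vop n (g m w) + (k * b / 2%:R) *: heis_vop (m + n) w.
Proof.
move=> lg gX gS; set c := k * b / 2%:R.
have lc : linear (fun x : B => c *: x) by exact: (lin_scale _ (@lin_id _ B)).
rewrite !vopE (zsum_lin (lg m) (vopterm_finz _ _)) (zsum_lin lc (vopterm_finz _ _)).
(* For m < 0 the degree of the annihilating half changes by m, and the summation index is moved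
   accordingly. *)
pose d : int := if m < 0 then m else 0.
have gE q : g m (vopterm n w q) = vopterm n (g m w) q + c *: vopterm (m + n) w (q + d).
  have [lS lM] := (opS_linear b, expminus_linear).
  rewrite {1}/vopterm (expminus_deriv lg gX) gS (expplus_deriv lg gX) -/c /vopterm /d.
  rewrite !(linD _ _ lS) !(linD _ _ (lM _)) -!addrA; congr (_ + _).
  case: (ltrgtP m 0) => m0.
  - rewrite mulr0 scale0r (lin0 (lM _)) !addr0 (linZ _ _ lS) (linZ _ _ (lM _)).
    by congr (_ *: expminus _ _); lia.
  - rewrite (lin0 lS) mulr0 scale0r !(lin0 (lM _)) !add0r addr0.
    by congr (_ *: expminus _ _); lia.
  - rewrite (lin0 lS) (lin0 (lM _)) add0r mulr1 addr0 (linZ _ _ (lM _)) m0.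
    by congr (_ *: expminus _ (S b (expplus _ _))); rewrite /=; lia.
have fd : finz (fun q => vopterm (m + n) w (q + d)).
  have [N f0] := vopterm_finz (m + n) w.
  by exists (N + `|d|)%N => q le; apply: f0; lia.
rewrite (zsum_ext gE) zsumD.
- by rewrite -(zsum_lin lc fd) (zsum_shift d (vopterm (m + n) w)) (zsum_lin lc (vopterm_finz _ _)).
- exact: vopterm_finz.
- exact: (finz_lin lc fd).
Qed.

End Halves.

Lemma vopX b n m w : X m (heis_vop b n w) = heis_vop b n (X m w).
Proof.
rewrite {1}/heisX (vop_deriv _ _ _ opU_linear opUX (fun m w => opUS m b w)).
rewrite (vop_deriv _ _ _ opF_linear opFX (fun m w => opFS m b w)).
by rewrite opprD addrACA subrr addr0 -(linB _ _ ((vop_field b).1 n)).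
Qed.

Lemma opF_vop b m n w :
  F m (heis_vop b n w) = heis_vop b n (F m w) + (k * b / 2%:R) *: heis_vop b (m + n) w.
Proof. exact: (vop_deriv _ _ _ opF_linear opFX (fun m w => opFS m b w)). Qed.

Lemma vopS a b n w : S a (heis_vop b n w) = heis_vop b n (S a w).
Proof. exact: (vop_pass n w (opS_linear a) (opSX a) (opSC a b)). Qed.

(** U - F is isotropic: its modes commute with each other and with all [S b], so no contraction
    arises between two vertex operators. *)
Lemma vopC a b m n w : heis_vop a m (heis_vop b n w) = heis_vop b n (heis_vop a m w).
Proof.
apply: vop_pass => [|p v|v]; first exact: (vop_field a).1.
  by rewrite vopX.
by rewrite vopS.
Qed.

Lemma vop_vac b a n : 0 <= n -> heis_vop b n (S a vac) = 0.
Proof.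
move=> n0; rewrite vopE; apply: zsum0 => q; rewrite /vopterm.
case: (ltrP 0 q) => q0.
  by rewrite expplus_vac // (lin0 (opS_linear b)) (lin0 (expminus_linear _ _)).
by rewrite /expminus ifF //; lia.
Qed.

Lemma vop_vac1 b a : heis_vop b (- 1) (S a vac) = S (a + b) vac.
Proof.
rewrite vopE (zsum1 (a := 0)) => [|q q0]; rewrite /vopterm.
  rewrite (_ : 0 - -1 - 1 = 0) //.
  by rewrite /expminus /expplus lexx !expser0 opSS addrC.
case: (ltrP 0 q) => q1.
  by rewrite expplus_vac // (lin0 (opS_linear b)) (lin0 (expminus_linear _ _)).
by rewrite /expminus ifF //; lia.
Qed.

Lemma heisF_field : isfield F.
Proof.
split=> // w; elim/module_ind: w => [|c v v' [N v0] [M v0']|m v [N v0]|m v [N v0]|b v [N v0]].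
- by exists 0 => n; exact: opF_cycvec.
- exists (Num.max N M) => n; rewrite ge_max => /andP[le le'].
  by rewrite opF_linear v0 // v0' // scaler0 addr0.
- exists (`|N| + `|m| + 1) => n le; rewrite opFF v0; last by lia.
  by rewrite (lin0 (opF_linear m)) add0r gt_eqF ?mulr0 ?scale0r //; lia.
- by exists N => n le; rewrite opFU v0 // (lin0 (opU_linear m)).
- exists (`|N| + 1) => n le; rewrite opFS v0; last by lia.
  by rewrite (lin0 (opS_linear b)) add0r gt_eqF ?mulr0 ?scale0r //; lia.
Qed.

End HeisenbergModule.

(** * The N=2 Verma module and the fermionic Fock module *)

Section KillingAbove.
Variables (K : fieldType) (X : choiceType).
Local Notation A := (freealg K X).
Variables (rel : A -> A -> Prop) (ann : A -> Prop).
Implicit Types (x y z : A) (w : cycmod rel ann).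

(** Used with [x] a fixed generator and [y] a high mode, so that [z] is again high and kills [w].
    The primed version takes the relation in the opposite order. *)
Lemma comm_kill x y z w : rel (comm x y) z -> act y w = 0 -> act z w = 0 ->
  act y (act x w) = 0.
Proof.
move=> r y0 z0; have E := act_comm w r; rewrite y0 z0 addr0 in E.
exact: (etrans (esym E) (lin0 (act_linear x))).
Qed.

Lemma comm_kill' x y z w : rel (comm y x) z -> act y w = 0 -> act z w = 0 ->
  act y (act x w) = 0.
Proof.
move=> r y0 z0; apply: (etrans (act_comm w r)); rewrite y0 z0 addr0.
exact: (lin0 (act_linear x)).
Qed.

Lemma acomm_kill x y z w : rel (acomm x y) z -> act y w = 0 -> act z w = 0 ->
  act y (act x w) = 0.
Proof.
move=> r y0 z0; have E := act_acomm w r; rewrite y0 z0 addr0 in E.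
by apply: oppr_inj; rewrite oppr0 -E (lin0 (act_linear x)).
Qed.

Lemma acomm_kill' x y z w : rel (acomm y x) z -> act y w = 0 -> act z w = 0 ->
  act y (act x w) = 0.
Proof.
move=> r y0 z0; apply: (etrans (act_acomm w r)); rewrite y0 z0 addr0.
by rewrite (lin0 (act_linear x)) oppr0.
Qed.

Lemma kill_scale c x w : act x w = 0 -> act (c *: x) w = 0.
Proof. by move=> x0; rewrite actZ x0 scaler0. Qed.

Lemma kill_opp x w : act x w = 0 -> act (- x) w = 0.
Proof. by move=> x0; rewrite actN x0 oppr0. Qed.

Lemma kill_add x y w : act x w = 0 -> act y w = 0 -> act (x + y) w = 0.
Proof. by move=> x0 y0; rewrite actD x0 y0 addr0. Qed.

Lemma kill_sub x y w : act x w = 0 -> act y w = 0 -> act (x - y) w = 0.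
Proof. by move=> x0 y0; rewrite actB x0 y0 subr0. Qed.

Lemma kill_delta c (m : int) w : 0 < m -> act (c * ((m == 0)%:R : K))%:A w = 0.
Proof. by move=> m0; rewrite act_alg gt_eqF // mulr0 scale0r. Qed.

Section Homogeneous.
Variable odd : pred X.

Definition hasparity (b : bool) x := signmap odd x = (-1) ^+ b *: x.

Lemma parity_homogeneous b x : hasparity b x -> homogeneous odd x.
Proof. by move=> hx; exists ((-1) ^+ b). Qed.

Lemma parity_gen g : hasparity (odd g) (gen K g).
Proof. exact: signmap_gen. Qed.

Lemma parity_scale b c x : hasparity b x -> hasparity b (c *: x).
Proof.
by move=> hx; exact: (eigen_scale c (signmap_linear odd) hx).
Qed.

Lemma parity_add b x y : hasparity b x -> hasparity b y -> hasparity b (x + y).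
Proof.
by move=> hx hy; exact: (eigen_add (signmap_linear odd) hx hy).
Qed.

Lemma parity_opp b x : hasparity b x -> hasparity b (- x).
Proof. by rewrite -[- x]scaleN1r; exact: parity_scale. Qed.

Lemma parity_sub b x y : hasparity b x -> hasparity b y -> hasparity b (x - y).
Proof. by move=> hx hy; exact: (parity_add hx (parity_opp hy)). Qed.

Lemma parity1 : hasparity false 1.
Proof. by rewrite /hasparity signmap1 expr0 scale1r. Qed.

Lemma parity0 b : hasparity b 0.
Proof.
by rewrite /hasparity (lin0 (signmap_linear odd)) [RHS]scaler0.
Qed.

Lemma parity_mul a b x y : hasparity a x -> hasparity b y -> hasparity (a (+) b) (x * y).
Proof.
move=> hx hy; rewrite /hasparity signr_addb.
exact: (morph_eigenM (@freealg_scaleAr K X) (signmapM odd) hx hy).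
Qed.

Lemma parity_comm a b x y : hasparity a x -> hasparity b y ->
  hasparity (a (+) b) (comm x y).
Proof.
move=> hx hy; apply: (parity_sub (parity_mul hx hy)).
by rewrite addbC; exact: (parity_mul hy hx).
Qed.

Lemma parity_acomm a b x y : hasparity a x -> hasparity b y ->
  hasparity (a (+) b) (acomm x y).
Proof.
move=> hx hy; apply: (parity_add (parity_mul hx hy)).
by rewrite addbC; exact: (parity_mul hy hx).
Qed.

End Homogeneous.

End KillingAbove.

Section VermaModule.
Variables (K : fieldType) (k h l : K).
Local Notation V := (verma k h l).
Local Notation L n := (gen K (n2L n)).
Local Notation H n := (gen K (n2H n)).
Local Notation G n := (gen K (n2G n)).
Local Notation Q n := (gen K (n2Q n)).
Local Notation par := (hasparity n2odd).

Lemma n2_rel_homogeneous u v : n2_rel k u v -> homogeneous n2odd (u - v).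
Proof.
have pL n : par false (L n) by exact: (parity_gen K n2odd (n2L n)).
have pH n : par false (H n) by exact: (parity_gen K n2odd (n2H n)).
have pG n : par true (G n) by exact: (parity_gen K n2odd (n2G n)).
have pQ n : par true (Q n) by exact: (parity_gen K n2odd (n2Q n)).
have pA c : par false (c%:A) by exact/parity_scale/parity1.
case=> m n; [apply: (@parity_homogeneous _ _ _ false)
  |apply: (@parity_homogeneous _ _ _ false)
  |apply: (@parity_homogeneous _ _ _ true)
  |apply: (@parity_homogeneous _ _ _ true)
  |apply: (@parity_homogeneous _ _ _ true)
  |apply: (@parity_homogeneous _ _ _ true)
  |apply: (@parity_homogeneous _ _ _ false)
  |apply: (@parity_homogeneous _ _ _ false)
  |apply: (@parity_homogeneous _ _ _ false)
  |apply: (@parity_homogeneous _ _ _ false)]; apply: parity_sub.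
- exact: (parity_comm (pL m) (pL n)).
- exact/parity_scale/pL.
- exact: (parity_comm (pH m) (pH n)).
- exact: pA.
- exact: (parity_comm (pL m) (pG n)).
- exact/parity_scale/pG.
- exact: (parity_comm (pH m) (pG n)).
- exact: pG.
- exact: (parity_comm (pL m) (pQ n)).
- exact/parity_scale/pQ.
- exact: (parity_comm (pH m) (pQ n)).
- exact/parity_opp/pQ.
- exact: (parity_comm (pL m) (pH n)).
- by apply: parity_add; [exact/parity_scale/pH | exact: pA].
- exact: (parity_acomm (pG m) (pQ n)).
- apply: parity_add; last exact: pA.
  by apply: parity_sub; [exact/parity_scale/pL | exact/parity_scale/pH].
- exact: (parity_acomm (pG m) (pG n)).
- exact: parity0.
- exact: (parity_acomm (pQ m) (pQ n)).
- exact: parity0.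
Qed.

Lemma n2_hw_homogeneous u : n2_hw h l u -> homogeneous n2odd u.
Proof.
case=> [n _|n _|n _|n _||].
- exact: (parity_homogeneous (parity_gen K n2odd (n2Q n))).
- exact: (parity_homogeneous (parity_gen K n2odd (n2G n))).
- exact: (parity_homogeneous (parity_gen K n2odd (n2L n))).
- exact: (parity_homogeneous (parity_gen K n2odd (n2H n))).
- apply: (@parity_homogeneous _ _ _ false); apply: parity_sub.
    exact: (parity_gen K n2odd (n2H 0)).
  exact/parity_scale/parity1.
- apply: (@parity_homogeneous _ _ _ false); apply: parity_sub.
    exact: (parity_gen K n2odd (n2L 0)).
  exact/parity_scale/parity1.
Qed.

Lemma vpar_linear : linear (@vpar K k h l).
Proof.
by apply: lin_opp; exact: (grade_linear n2_rel_homogeneous n2_hw_homogeneous).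
Qed.

Lemma vpar_vhw : vpar (vhw k h l) = - vhw k h l.
Proof. by congr (- _); exact: (grade_vac n2_rel_homogeneous n2_hw_homogeneous). Qed.

Lemma vpar_act g (w : V) : vpar (act (gen K g) w : V) =
  (-1) ^+ n2odd g *: act (gen K g) (vpar w).
Proof.
rewrite (linN _ (act_linear _)) scalerN; congr (- _).
exact: (grade_act n2_rel_homogeneous n2_hw_homogeneous).
Qed.

(** [on_ferm] applies [vpar] to the N = 2 factor, so this sign is what makes the G modes anticommute
    with the fermions on the tensor product. *)
Lemma opG_vpar n (w : V) : opG n (vpar w) = - vpar (opG n w).
Proof. by rewrite /opG vpar_act expr1 scaleN1r opprK. Qed.

Lemma opQ_vpar n (w : V) : opQ n (vpar w) = - vpar (opQ n w).
Proof. by rewrite /opQ vpar_act expr1 scaleN1r opprK. Qed.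

Lemma opH_vpar n (w : V) : opH n (vpar w) = vpar (opH n w).
Proof. by rewrite /opH vpar_act expr0 scale1r. Qed.

Lemma opGG m n (w : V) : opG m (opG n w) = - opG n (opG m w).
Proof. by rewrite /opG (act_acomm w (n2_GG k m n)) act0 addr0. Qed.

Lemma opQQ m n (w : V) : opQ m (opQ n w) = - opQ n (opQ m w).
Proof. by rewrite /opQ (act_acomm w (n2_QQ k m n)) act0 addr0. Qed.

Lemma opHG m n (w : V) : opH m (opG n w) = opG n (opH m w) + opG (m + n) w.
Proof. exact: (act_comm w (n2_HG k m n)). Qed.

Lemma opHQ m n (w : V) : opH m (opQ n w) = opQ n (opH m w) - opQ (m + n) w.
Proof. by rewrite /opH /opQ (act_comm w (n2_HQ k m n)) actN. Qed.

(** The commutators mix the four families, hence a single induction with a common bound for all of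
    them. *)
Lemma verma_smooth (w : V) : exists N : int, forall n, N <= n ->
  [/\ act (L n) w = 0, act (H n) w = 0, act (G n) w = 0 & act (Q n) w = 0].
Proof.
elim/cyc_ind: w => [|c w w' [N w0] [N' w'0]|g w [N w0]].
- exists 1 => n n1; split; apply: act_ann.
  + exact: n2_hwL.
  + exact: n2_hwH.
  + by apply: n2_hwG; lia.
  + exact: n2_hwQ.
- exists (Num.max N N') => n; rewrite ge_max => /andP[/w0[a0 a1 a2 a3] /w'0[b0 b1 b2 b3]].
  split; rewrite act_linear.
  + by rewrite a0 b0 scaler0 addr0.
  + by rewrite a1 b1 scaler0 addr0.
  + by rewrite a2 b2 scaler0 addr0.
  + by rewrite a3 b3 scaler0 addr0.
(* The bound keeps n and n + m above N and makes n + m positive, which removes the central terms. *)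
have sum0 m n : `|N| + `|m| + 1 <= n -> [/\ N <= n, N <= m + n, N <= n + m,
    0 < m + n & 0 < n + m] by move=> le; split; lia.
have [kL kH kG kQ] : [/\ forall n, N <= n -> act (L n) w = 0,
    forall n, N <= n -> act (H n) w = 0, forall n, N <= n -> act (G n) w = 0 &
    forall n, N <= n -> act (Q n) w = 0].
  by split=> n /w0[].
case: g => m; exists (`|N| + `|m| + 1) => n /sum0[le le1 le2 le3 le4].
- split.
  + apply: (comm_kill' (n2_LL k n m)); first exact: kL.
    exact/kill_scale/kL.
  + apply: (comm_kill (n2_LH k m n)); first exact: kH.
    by apply: kill_add; [exact/kill_scale/kH | exact: kill_delta].
  + apply: (comm_kill (n2_LG k m n)); first exact: kG.
    exact/kill_scale/kG.
  + apply: (comm_kill (n2_LQ k m n)); first exact: kQ.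
    exact/kill_scale/kQ.
- split.
  + apply: (comm_kill' (n2_LH k n m)); first exact: kL.
    by apply: kill_add; [exact/kill_scale/kH | exact: kill_delta].
  + apply: (comm_kill' (n2_HH k n m)); first exact: kH.
    exact: kill_delta.
  + by apply: (comm_kill (n2_HG k m n)); exact: kG.
  + apply: (comm_kill (n2_HQ k m n)); first exact: kQ.
    exact/kill_opp/kQ.
- split.
  + apply: (comm_kill' (n2_LG k n m)); first exact: kL.
    exact/kill_scale/kG.
  + by apply: (comm_kill' (n2_HG k n m)); [exact: kH | exact: kG].
  + apply: (acomm_kill' (n2_GG k n m)); first exact: kG.
    exact: act0.
  + apply: (acomm_kill (n2_GQ k m n)); first exact: kQ.
    apply: kill_add; last exact: kill_delta.
    by apply: kill_sub; [exact/kill_scale/kL | exact/kill_scale/kH].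
- split.
  + apply: (comm_kill' (n2_LQ k n m)); first exact: kL.
    exact/kill_scale/kQ.
  + apply: (comm_kill' (n2_HQ k n m)); first exact: kH.
    exact/kill_opp/kQ.
  + apply: (acomm_kill' (n2_GQ k n m)); first exact: kG.
    apply: kill_add; last exact: kill_delta.
    by apply: kill_sub; [exact/kill_scale/kL | exact/kill_scale/kH].
  + apply: (acomm_kill' (n2_QQ k n m)); first exact: kQ.
    exact: act0.
Qed.

End VermaModule.

Section FermionFock.
Variable K : fieldType.
Local Notation psi n := (gen K (fpsi n)).
Local Notation bpsi n := (gen K (fbpsi n)).

Lemma oppsi_oppsi m n (w : ffock K) : oppsi m (oppsi n w) = - oppsi n (oppsi m w).
Proof. by rewrite /oppsi (act_acomm w (f_pp K m n)) act0 addr0. Qed.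

Lemma opbpsi_opbpsi m n (w : ffock K) : opbpsi m (opbpsi n w) = - opbpsi n (opbpsi m w).
Proof. by rewrite /opbpsi (act_acomm w (f_bb K m n)) act0 addr0. Qed.

Lemma ffock_smooth (w : ffock K) : exists N : int, forall n, N <= n ->
  oppsi n w = 0 /\ opbpsi n w = 0.
Proof.
elim/cyc_ind: w => [|c w w' [N w0] [N' w'0]|g w [N w0]].
- exists 1 => n n1; split; apply: act_ann; first exact: f_vacp.
  by apply: f_vacb; lia.
- exists (Num.max N N') => n; rewrite ge_max => /andP[/w0[a0 a1] /w'0[b0 b1]].
  split; rewrite [LHS]act_linear.
    by rewrite [act _ w]a0 [act _ w']b0 scaler0 addr0.
  by rewrite [act _ w]a1 [act _ w']b1 scaler0 addr0.
have sum0 m n : `|N| + `|m| + 1 <= n -> [/\ N <= n, m + n != 0 & n + m != 0]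
  by move=> le; split; lia.
have d0 (m : int) : m != 0 -> act ((m == 0)%:R : K)%:A w = 0.
  by move=> /negbTE ->; rewrite act_alg scale0r.
case: g => m; exists (`|N| + `|m| + 1) => n /sum0[/w0[p0 b0] le1 le2]; split.
- by apply: (acomm_kill' (f_pp K n m)); [exact: p0 | exact: act0].
- by apply: (acomm_kill (f_pb K m n)); [exact: b0 | exact: d0].
- by apply: (acomm_kill' (f_pb K n m)); [exact: p0 | exact: d0].
- by apply: (acomm_kill' (f_bb K n m)); [exact: b0 | exact: act0].
Qed.

End FermionFock.

(** * The bosonic Fock modules as an instance of the Heisenberg module *)

Section BosonFock.
Variables (K : numFieldType) (k : K).
Local Notation B := (bfock k).
Local Notation F n := (@opF K k n).
Local Notation U n := (@opU K k n).
Local Notation S b := (@opS K k b).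
Local Notation vac := (cycvec (b_rel k) (@b_vac K)).
Local Notation delta m := (((m : int) == 0)%:R : K).

Let lF n : linear (F n). Proof. exact: act_linear. Qed.
Let lU n : linear (U n). Proof. exact: act_linear. Qed.
Let lS b : linear (S b). Proof. exact: act_linear. Qed.

Let FF m n w : F m (F n w) = F n (F m w) + (- (k / 2%:R) * m%:~R * delta (m + n)) *: w.
Proof. by rewrite /opF (act_comm _ (b_FF k m n)) act_alg. Qed.

Let UU m n w : U m (U n w) = U n (U m w) + (k / 2%:R * m%:~R * delta (m + n)) *: w.
Proof. by rewrite /opU (act_comm _ (b_UU k m n)) act_alg. Qed.

Let FU m n w : F m (U n w) = U n (F m w).
Proof. by rewrite /opF /opU (act_comm _ (b_FU k m n)) act0 addr0. Qed.

Let FS m b w : F m (S b w) = S b (F m w) + (k * b / 2%:R * delta m) *: S b w.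
Proof. by rewrite /opF /opS (act_comm _ (b_FS k m b)) actZ. Qed.

Let US m b w : U m (S b w) = S b (U m w) + (k * b / 2%:R * delta m) *: S b w.
Proof. by rewrite /opU /opS (act_comm _ (b_US k m b)) actZ. Qed.

Let SS a b w : S a (S b w) = S (a + b) w.
Proof. by rewrite /opS -actM (act_rel _ (b_SS k a b)). Qed.

Let S0 w : S 0 w = w.
Proof. by rewrite /opS (act_rel _ (b_S0 k)) act1. Qed.

Let F_vac n : 0 <= n -> F n vac = 0.
Proof. by move=> n0; rewrite /opF (act_ann _ (b_vacF K n0)). Qed.

Let U_vac n : 0 <= n -> U n vac = 0.
Proof. by move=> n0; rewrite /opU (act_ann _ (b_vacU K n0)). Qed.

Let bfock_ind (P : B -> Prop) : P vac ->
  (forall c w w', P w -> P w' -> P (c *: w + w')) ->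
  (forall n w, P w -> P (F n w)) -> (forall n w, P w -> P (U n w)) ->
  (forall b w, P w -> P (S b w)) -> forall w, P w.
Proof. by move=> Pv PD PF PU PS; apply: cyc_ind => // [[n|n|b]] w Pw; [exact: PF|exact: PU|exact: PS]. Qed.

Lemma opF_field : isfield (@opF K k).
Proof. exact: (heisF_field lF lU lS FF FU FS F_vac bfock_ind). Qed.

Lemma bvop_field b : isfield (@vop K k b).
Proof. exact: (vop_field lF lU lS FF UU FU FS US S0 F_vac U_vac bfock_ind b). Qed.

Lemma bvop_opF b m n w : F m (vop b n w) =
  vop b n (F m w) + (k * b / 2%:R) *: vop b (m + n) w.
Proof. exact: (opF_vop lF lU lS FF UU FU FS US S0 F_vac U_vac bfock_ind b). Qed.

Lemma bvopC a b m n w : vop a m (vop b n w) = vop b n (vop a m w :> B).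
Proof. exact: (vopC lF lU lS FF UU FU FS US SS S0 F_vac U_vac bfock_ind). Qed.

Lemma bvop_vac b a n : 0 <= n -> vop b n (bvac k a) = 0.
Proof. by move=> n0; exact: (vop_vac lF lU lS FS US F_vac U_vac). Qed.

Lemma bvop_vac1 b a : vop b (- 1) (bvac k a) = bvac k (a + b).
Proof. exact: (vop_vac1 lF lU lS FS US SS F_vac U_vac). Qed.

Lemma bopF_vac a n : 0 < n -> F n (bvac k a) = 0.
Proof. exact: (opF_vac lS FS F_vac). Qed.

Lemma bopF0_vac a : F 0 (bvac k a) = (k * a / 2%:R) *: bvac k a.
Proof. exact: (opF0_vac lS FS F_vac). Qed.

End BosonFock.

(** * Products of the currents on pure tensors *)

Section ThreefoldTensor.
Variables (K : numFieldType) (V B F : lmodType K) (par : V -> V).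
Hypothesis lpar : linear par.

Local Notation W := (tensmod (tensmod V B) F).
Implicit Types (w : W).

Definition tstate (m : V) (b : B) (f : F) : W := tens (tens m b) f.
Definition on1 (X : V -> V) : W -> W := tmap (tmap X id) id.
Definition on2 (X : B -> B) : W -> W := tmap (tmap id X) id.
Definition on3 (X : F -> F) : W -> W := tmap (tmap par id) X.

Lemma tstate_ind (P : W -> Prop) : P 0 ->
  (forall m b f w, P w -> P (tstate m b f + w)) -> forall w, P w.
Proof.
move=> P0 PD; elim/tens_ind => // u f w Pw.
elim/tens_ind: u w Pw => [|m b u IH] w Pw; first by rewrite tens0l add0r.
by rewrite tensDl -addrA; apply: PD; apply: IH.
Qed.

Lemma on1_linear X : linear X -> linear (on1 X).
Proof.
move=> lX; apply: tmap_linear; last exact: lin_id.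
by apply: tmap_linear => //; exact: lin_id.
Qed.

Lemma on2_linear X : linear X -> linear (on2 X).
Proof.
move=> lX; apply: tmap_linear; last exact: lin_id.
by apply: tmap_linear => //; exact: lin_id.
Qed.

Lemma on3_linear X : linear X -> linear (on3 X).
Proof.
move=> lX; apply: tmap_linear => //.
by apply: tmap_linear => //; exact: lin_id.
Qed.

Lemma on1_tstate X m b f : linear X -> on1 X (tstate m b f) = tstate (X m) b f.
Proof.
move=> lX; apply: (etrans (tmap_tens (tmap_linear lX (@lin_id K B)) (@lin_id K F) _ _)).
exact: (congr1 (fun u => tens u f) (tmap_tens lX (@lin_id K B) m b)).
Qed.

Lemma on2_tstate X m b f : linear X -> on2 X (tstate m b f) = tstate m (X b) f.
Proof.
move=> lX; apply: (etrans (tmap_tens (tmap_linear (@lin_id K V) lX) (@lin_id K F) _ _)).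
exact: (congr1 (fun u => tens u f) (tmap_tens (@lin_id K V) lX m b)).
Qed.

Lemma on3_tstate X m b f : linear X -> on3 X (tstate m b f) = tstate (par m) b (X f).
Proof.
move=> lX; apply: (etrans (tmap_tens (tmap_linear lpar (@lin_id K B)) lX _ _)).
exact: (congr1 (fun u => tens u (X f)) (tmap_tens lpar (@lin_id K B) m b)).
Qed.

Lemma tstate_lin1 b f : linear (fun m => tstate m b f).
Proof. by move=> c m m'; rewrite /tstate tens_linl tens_linl. Qed.

Lemma tstate_lin2 m f : linear (fun b => tstate m b f).
Proof. by move=> c b b'; rewrite /tstate tens_linr tens_linl. Qed.

Lemma tstate_lin3 m b : linear (fun f => tstate m b f).
Proof. by move=> c f f'; rewrite /tstate tens_linr. Qed.

End ThreefoldTensor.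

Section DescendingProducts.
Variables (T : Type) (A : int -> T -> T).

(* [A_(c-n+1) ... A_c w]. *)
Fixpoint descend (c : int) (n : nat) (w : T) : T :=
  if n is n'.+1 then A (c - n'%:Z) (descend c n' w) else w.

Lemma descendS c n w : descend c n.+1 w = A (c - n%:Z) (descend c n w).
Proof. by []. Qed.

Lemma foldr_descend (m c : int) (i n : nat) w : m + i%:Z + n%:Z = c + 1 ->
  foldr (fun (i : nat) v => A (m + i%:Z) v) w (iota i n) = descend c n w.
Proof.
elim: n i => //= n IH i E; rewrite IH; last by lia.
by congr (A _ _); lia.
Qed.

(** For n = 0 the lower index is c + 1, where [modes] falls back to the empty product. *)
Lemma modes_descend m c n w : m = c - n%:Z + 1 -> modes A m c w = descend c n w.
Proof.
move=> ->; rewrite /modes; case: n => [|n]; first by rewrite ifF //; lia.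
rewrite ifT; last by lia.
rewrite (_ : absz _ = n.+1); last by lia.
by apply: foldr_descend; lia.
Qed.

End DescendingProducts.

(** Translates between the uniform mode numbering of [vfield] and the customary one of G and psi. *)
Lemma descend_shift (T : Type) (A : int -> T -> T) (d c : int) n w :
  descend (fun i => A (i + d)) c n w = descend A (c + d) n w.
Proof. by elim: n => //= n ->; congr (A _ _); lia. Qed.

Section DescendingLinear.
Variables (K : fieldType) (W : lmodType K).

Lemma descend_pass (A : int -> W -> W) (D : W -> W) s c n w :
  (forall i, linear (A i)) -> (forall i v, D (A i v) = s *: A i (D v)) ->
  D (descend A c n w) = s ^+ n *: descend A c n (D w).
Proof.
move=> lA DA; elim: n => [|n IH] /=; first by rewrite expr0 scale1r.
by rewrite DA IH (linZ _ _ (lA _)) scalerA -exprS.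
Qed.

Lemma descendZ (A : int -> W -> W) s c n w : (forall i, linear (A i)) ->
  descend A c n (s *: w) = s *: descend A c n w.
Proof. by move=> lA; elim: n => //= n ->; rewrite (linZ _ _ (lA _)). Qed.

Lemma descend_descend (A D : int -> W -> W) s c d n m w :
  (forall i, linear (A i)) -> (forall i, linear (D i)) ->
  (forall i j v, D j (A i v) = s *: A i (D j v)) ->
  descend D d m (descend A c n w) = s ^+ (n * m) *: descend A c n (descend D d m w).
Proof.
move=> lA lD DA; elim: m => [|m IH] /=; first by rewrite muln0 expr0 scale1r.
rewrite IH (linZ _ _ (lD _)) (descend_pass _ _ _ lA (DA^~ _)) scalerA -exprD.
by rewrite mulnS addnC.
Qed.

End DescendingLinear.

(* [W] stands for the threefold tensor product, [tstate] for its pure tensors. *)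
Section TensorOperators.
Variables (K : numFieldType) (V B F W : lmodType K) (par : V -> V).
Variable tstate : V -> B -> F -> W.
Variables (on1 : (V -> V) -> W -> W) (on2 : (B -> B) -> W -> W)
  (on3 : (F -> F) -> W -> W).
Hypothesis lpar : linear par.
Hypotheses (tstate_lin1 : forall b f, linear (fun m => tstate m b f))
  (tstate_lin2 : forall m f, linear (fun b => tstate m b f))
  (tstate_lin3 : forall m b, linear (fun f => tstate m b f)).
Hypothesis tstate_ind : forall P : W -> Prop, P 0 ->
  (forall m b f w, P w -> P (tstate m b f + w)) -> forall w, P w.
Hypotheses (on1_linear : forall X, linear X -> linear (on1 X))
  (on2_linear : forall X, linear X -> linear (on2 X))
  (on3_linear : forall X, linear X -> linear (on3 X)).
Hypotheses
  (on1_tstate : forall X m b f, linear X -> on1 X (tstate m b f) = tstate (X m) b f)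
  (on2_tstate : forall X m b f, linear X -> on2 X (tstate m b f) = tstate m (X b) f)
  (on3_tstate : forall X m b f, linear X ->
     on3 X (tstate m b f) = tstate (par m) b (X f)).
Implicit Types (w : W).

Lemma tstate_ext (f g : W -> W) : linear f -> linear g ->
  (forall m b x, f (tstate m b x) = g (tstate m b x)) -> f =1 g.
Proof.
move=> lf lg fg; elim/tstate_ind => [|m b x w IH]; first by rewrite !lin0.
by rewrite (linD _ _ lf) (linD _ _ lg) fg IH.
Qed.

Lemma tstate0 m b f : [/\ tstate 0 b f = 0, tstate m 0 f = 0 & tstate m b 0 = 0].
Proof.
by split; [exact: (lin0 (tstate_lin1 b f)) | exact: (lin0 (tstate_lin2 m f))
  | exact: (lin0 (tstate_lin3 m b))].
Qed.

Lemma tstateZ c m b f : [/\ tstate (c *: m) b f = c *: tstate m b f,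
  tstate m (c *: b) f = c *: tstate m b f & tstate m b (c *: f) = c *: tstate m b f].
Proof.
by split; [exact: (linZ _ _ (tstate_lin1 b f)) | exact: (linZ _ _ (tstate_lin2 m f))
  | exact: (linZ _ _ (tstate_lin3 m b))].
Qed.

Lemma tstate_smooth (A : int -> W -> W) : (forall n, linear (A n)) ->
  (forall m b f, exists N : int, forall n, N <= n -> A n (tstate m b f) = 0) ->
  isfield A.
Proof.
move=> lA A0; split=> // w; elim/tstate_ind: w => [|m b f w [N AN]].
  by exists 0 => n _; exact: lin0.
have [M AM] := A0 m b f; exists (Num.max N M) => n; rewrite ge_max => /andP[le le'].
by rewrite (linD _ _ (lA n)) AM // AN // addr0.
Qed.

Lemma on1_field X : isfield X -> isfield (fun n => on1 (X n)).
Proof.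
move=> [lX sX]; apply: tstate_smooth => [n|m b f]; first exact: on1_linear.
have [N XN] := sX m; exists N => n le.
by rewrite on1_tstate // XN //; have [-> _ _] := tstate0 m b f.
Qed.

Lemma on2_field X : isfield X -> isfield (fun n => on2 (X n)).
Proof.
move=> [lX sX]; apply: tstate_smooth => [n|m b f]; first exact: on2_linear.
have [N XN] := sX b; exists N => n le.
by rewrite on2_tstate // XN //; have [_ -> _] := tstate0 m b f.
Qed.

Lemma on3_field X : isfield X -> isfield (fun n => on3 (X n)).
Proof.
move=> [lX sX]; apply: tstate_smooth => [n|m b f]; first exact: on3_linear.
have [N XN] := sX f; exists N => n le.
by rewrite on3_tstate // XN //; have [_ _ ->] := tstate0 (par m) b f.
Qed.

Lemma exchanges_tstate s (A C : int -> W -> W) :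
  (forall n, linear (A n)) -> (forall n, linear (C n)) ->
  (forall p q m b f, A p (C q (tstate m b f)) = s *: C q (A p (tstate m b f))) ->
  exchanges s A C.
Proof.
move=> lA lC AC p q; apply: (tstate_ext (f := A p \o C q)
   (g := fun w => s *: C q (A p w))) => [||m b f].
- exact: (lin_comp (lC q) (lA p)).
- exact: (lin_scale s (lin_comp (lA p) (lC q))).
- exact: AC.
Qed.

Lemma on1_on2 X Y : (forall n, linear (X n)) -> (forall n, linear (Y n)) ->
  exchanges 1 (fun n => on2 (Y n)) (fun n => on1 (X n)).
Proof.
move=> lX lY; apply: exchanges_tstate => [n|n|p q m b f].
- exact: on2_linear.
- exact: on1_linear.
- by rewrite scale1r on1_tstate // !on2_tstate // on1_tstate.
Qed.

Lemma on2_on3 Y Z : (forall n, linear (Y n)) -> (forall n, linear (Z n)) ->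
  exchanges 1 (fun n => on2 (Y n)) (fun n => on3 (Z n)).
Proof.
move=> lY lZ; apply: exchanges_tstate => [n|n|p q m b f].
- exact: on2_linear.
- exact: on3_linear.
- by rewrite scale1r on3_tstate // !on2_tstate // on3_tstate.
Qed.

(** The third-factor operator carries [par] on the first factor, so the exchange sign is the one
    between [X] and [par]. *)
Lemma on1_on3 s X Z : (forall n, linear (X n)) -> (forall n, linear (Z n)) ->
  (forall n v, X n (par v) = s *: par (X n v)) ->
  exchanges s (fun n => on1 (X n)) (fun n => on3 (Z n)).
Proof.
move=> lX lZ Xpar; apply: exchanges_tstate => [n|n|p q m b f].
- exact: on1_linear.
- exact: on3_linear.
- rewrite on3_tstate // !on1_tstate // on3_tstate // Xpar.
  by have [-> _ _] := tstateZ s (par (X p m)) b (Z q f).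
Qed.

Lemma on2_on2 Y Z : (forall n, linear (Y n)) -> (forall n, linear (Z n)) ->
  exchanges 1 Y Z -> exchanges 1 (fun n => on2 (Y n)) (fun n => on2 (Z n)).
Proof.
move=> lY lZ YZ; apply: exchanges_tstate => [n|n|p q m b f].
- exact: on2_linear.
- exact: on2_linear.
- by rewrite !on2_tstate // YZ !scale1r.
Qed.

Lemma on3_on3 s Z : (forall n, linear (Z n)) ->
  exchanges s Z Z -> exchanges s (fun n => on3 (Z n)) (fun n => on3 (Z n)).
Proof.
move=> lZ ZZ; apply: exchanges_tstate => [n|n|p q m b f].
- exact: on3_linear.
- exact: on3_linear.
- by rewrite !on3_tstate // ZZ; have [_ _ ->] := tstateZ s (par (par m)) b (Z q (Z p f)).
Qed.

Lemma on2_deriv (Y Z : int -> B -> B) c m n w :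
  (forall n, linear (Y n)) -> (forall n, linear (Z n)) ->
  (forall m n b, Y m (Z n b) = Z n (Y m b) + c *: Z (m + n) b) ->
  on2 (Y m) (on2 (Z n) w) = on2 (Z n) (on2 (Y m) w) + c *: on2 (Z (m + n)) w.
Proof.
move=> lY lZ YZ; move: w; apply: (tstate_ext (f := on2 (Y m) \o on2 (Z n))
  (g := fun w => on2 (Z n) (on2 (Y m) w) + c *: on2 (Z (m + n)) w)) => [||v b f].
- by apply: lin_comp; exact: on2_linear.
- apply: lin_add; last by apply: lin_scale; exact: on2_linear.
  by apply: (lin_comp (f := on2 (Y m)) (g := on2 (Z n))); exact: on2_linear.
- by rewrite /= !on2_tstate // YZ (linD _ _ (tstate_lin2 v f)) (linZ _ _ (tstate_lin2 v f)).
Qed.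

(** * Products of currents on a tensor of vacua *)

Section ChargedProducts.
Variables (k h al ep eta : K).
Variables (Gam Hop : int -> V -> V) (Fop : int -> B -> B) (vp : K -> int -> B -> B)
  (chi : int -> F -> F) (v : V) (bv : K -> B) (fv : F).
Hypotheses (k0 : k != 0).
Hypotheses (fGam : isfield Gam) (fHop : isfield Hop) (fFop : isfield Fop)
  (fvp : forall b, isfield (vp b)) (fchi : isfield chi).
Hypotheses (Gam_par : forall n u, Gam n (par u) = -1 *: par (Gam n u))
  (Hop_par : forall n u, Hop n (par u) = 1 *: par (Hop n u)).
Hypotheses (Gam_Gam : forall m n u, Gam m (Gam n u) = - Gam n (Gam m u))
  (Hop_Gam : forall m n u, Hop m (Gam n u) = Gam n (Hop m u) + eta *: Gam (m + n) u)
  (chi_chi : exchanges (-1) chi chi)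
  (vpC : forall b c, exchanges 1 (vp b) (vp c))
  (Fop_vp : forall b m n u,
     Fop m (vp b n u) = vp b n (Fop m u) + (k * b / 2%:R) *: vp b (m + n) u).
Hypotheses (par_v : par v = - v)
  (Gam_v : forall n, 0 < n -> Gam n v = 0) (Hop_v : forall n, 0 < n -> Hop n v = 0)
  (Hop0_v : Hop 0 v = h *: v) (chi_fv : forall n, 0 <= n -> chi n fv = 0).
Hypotheses (vp_bv : forall b a n, 0 <= n -> vp b n (bv a) = 0)
  (vp1_bv : forall b a, vp b (- 1) (bv a) = bv (a + b))
  (Fop_bv : forall a n, 0 < n -> Fop n (bv a) = 0)
  (Fop0_bv : forall a, Fop 0 (bv a) = (k * a / 2%:R) *: bv a).

Let G := VField true (fun n => on1 (Gam n)).
Let H := VField false (fun n => on1 (Hop n)).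
Let X := VField true (fun n => on3 (chi n)).
Let dF := VField false (fun n => on2 (Fop n)).
Let VV b := VField false (fun n => on2 (vp b n)).

Let E := curE X (VV k^-1).
Let J := curF G X H dF (VV (- k^-1)) al ep (k + 2%:R^-1).

Let fG : isfield (mode G). Proof. exact: on1_field. Qed.
Let fH : isfield (mode H). Proof. exact: on1_field. Qed.
Let fX : isfield (mode X). Proof. exact: on3_field. Qed.
Let fdF : isfield (mode dF). Proof. exact: on2_field. Qed.
Let fVV b : isfield (mode (VV b)). Proof. by apply: on2_field; exact: fvp. Qed.

Let XX : exchanges (-1) (mode X) (mode X).
Proof. exact: (on3_on3 fchi.1 chi_chi). Qed.
Let GX : exchanges (-1) (mode G) (mode X).
Proof. exact: (on1_on3 fGam.1 fchi.1 Gam_par). Qed.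
Let HX : exchanges 1 (mode H) (mode X).
Proof. exact: (on1_on3 fHop.1 fchi.1 Hop_par). Qed.
Let FX : exchanges 1 (mode dF) (mode X).
Proof. exact: (on2_on3 fFop.1 fchi.1). Qed.
Let VX b : exchanges 1 (mode (VV b)) (mode X).
Proof. exact: (on2_on3 (fvp b).1 fchi.1). Qed.
Let VG b : exchanges 1 (mode (VV b)) (mode G).
Proof. exact: (on1_on2 fGam.1 (fvp b).1). Qed.
Let VH b : exchanges 1 (mode (VV b)) (mode H).
Proof. exact: (on1_on2 fHop.1 (fvp b).1). Qed.
Let VVC b c : exchanges 1 (mode (VV b)) (mode (VV c)).
Proof. exact: (on2_on2 (fvp b).1 (fvp c).1 (vpC b c)). Qed.

Let dF_V m s w : mode dF m (mode (VV k^-1) s w) =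
  mode (VV k^-1) s (mode dF m w) + 2%:R^-1 *: mode (VV k^-1) (m + s) w.
Proof.
apply: (on2_deriv m s w fFop.1 (fvp k^-1).1) => p q b.
by rewrite Fop_vp divff // mul1r.
Qed.

Let lE i : linear (E i). Proof. exact: (curE_linear fX (fVV _)). Qed.
Let lJ i : linear (J i).
Proof. exact: (curF_linear _ _ _ fG fX fH fdF (fVV _)). Qed.

Let JE n m w : J n (E m w) = - E m (J n w).
Proof.
exact: (curF_curE al ep (k + 2%:R^-1) fG fX fH fdF (fVV _) (fVV _) erefl erefl
  erefl erefl erefl erefl XX GX HX FX (VX _) (VX _) (VG _) (VH _) (VVC _ _) dF_V).
Qed.

Let phi n := descend chi (- 1) n fv.
Let gam s := descend Gam 0 s v.

(** A mode with p >= 0 reaches the vacuum and kills it; one with -n <= p <= -1 already occurs in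
    [phi n], and its square is 0 because 2 is invertible. *)
Let chi_phi n (p : int) : - n%:Z <= p -> chi p (phi n) = 0.
Proof.
elim: n p => [|n IH] p le; first by apply: chi_fv; lia.
rewrite /phi /= -/(phi n) chi_chi scaleN1r; apply/eqP; rewrite oppr_eq0; apply/eqP.
case: (lerP (- n%:Z) p) => lp; first by rewrite IH // (lin0 (fchi.1 _)).
have -> : p = - 1 - n%:Z by lia.
set q := - 1 - n%:Z; have : chi q (chi q (phi n)) = - chi q (chi q (phi n)).
  by rewrite {1}chi_chi scaleN1r.
move/eqP; rewrite -addr_eq0 -mulr2n -scaler_nat scaler_eq0 pnatr_eq0 /=.
by move/eqP.
Qed.

Let Gam_gam s (p : int) : - s%:Z < p -> Gam p (gam s) = 0.
Proof.
elim: s p => [|s IH] p le; first by apply: Gam_v; lia.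
rewrite /gam /= -/(gam s) Gam_Gam; apply/eqP; rewrite oppr_eq0; apply/eqP.
case: (ltrP (- s%:Z) p) => lp; first by rewrite IH // (lin0 (fGam.1 _)).
have -> : p = 0 - s%:Z by lia.
set q := 0 - s%:Z; have : Gam q (Gam q (gam s)) = - Gam q (Gam q (gam s)).
  by rewrite {1}Gam_Gam.
move/eqP; rewrite -addr_eq0 -mulr2n -scaler_nat scaler_eq0 pnatr_eq0 /=.
by move/eqP.
Qed.

(** The commutator of [Hop_p] with the leftmost factor is a [Gam] of higher index, which kills the
    rest of the product. *)
Let Hop_gam s (p : int) : 0 < p -> Hop p (gam s) = 0.
Proof.
move=> p0; elim: s => [|s IH]; first exact: Hop_v.
rewrite /gam /= -/(gam s) Hop_Gam IH (lin0 (fGam.1 _)) add0r Gam_gam ?scaler0 //.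
by lia.
Qed.

Let Hop0_gam s : Hop 0 (gam s) = (h + eta * s%:R) *: gam s.
Proof.
elim: s => [|s IH]; first by rewrite mulr0 addr0.
rewrite /gam /= -/(gam s) Hop_Gam IH (linZ _ _ (fGam.1 _)).
rewrite (_ : 0 + (0 - s%:Z) = 0 - s%:Z) ?add0r // -scalerDl.
by rewrite -addrA -[s.+1%:R]natr1 mulrDr mulr1.
Qed.

(** Each [chi] passes the odd vector [v] and picks up -1 from [par_v]; each vertex operator adds 1/k
    to the momentum. *)
Lemma descend_E a n : descend E (- 1) n (tstate v (bv a) fv) =
  (-1) ^+ n *: tstate v (bv (a + n%:R / k)) (phi n).
Proof.
elim: n => [|n IH]; first by rewrite /= mul0r addr0 expr0 scale1r.
rewrite descendS IH (linZ _ _ (lE _)) exprSr -scalerA; congr (_ *: _).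
have -> : -1 - n%:Z = - n.+1%:Z by lia.
set b := a + n%:R / k.
rewrite /E (curE_top (w' := tstate v (bv (b + k^-1)) (phi n)) fX (fVV _)
  erefl erefl (VX _)).
- rewrite /X /= on3_tstate ?par_v; last exact: fchi.1.
  rewrite (linN _ (tstate_lin1 _ _)) scaleN1r; congr (- tstate v (bv _) (chi _ _)).
    by rewrite /b -[n.+1%:R]natr1 mulrDl mul1r addrA.
  by lia.
- move=> p le; rewrite /X /= on3_tstate; last exact: fchi.1.
  by rewrite chi_phi // (lin0 (tstate_lin3 _ _)).
- move=> s s0; rewrite /VV /= on2_tstate; last exact: (fvp _).1.
  by rewrite vp_bv // (lin0 (tstate_lin2 _ _)).
- rewrite /VV /= on2_tstate; last exact: (fvp _).1.
  by rewrite vp1_bv.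
Qed.

(** The chi-vacuum [phi n] stays fixed while [Gam] factors accumulate and the momentum drops by 1/k
    each time. The coefficient condition concerns s = n only. *)
Lemma descend_J a n M : (forall s, (s < M)%N -> (s < n)%N \/ s = n /\
    ep * (k * a / 2%:R) - (h + eta * n%:R) / 2%:R + ep * (k + 2%:R^-1) * n%:R = 0) ->
  descend J 0 M (tstate v (bv (a + n%:R / k)) (phi n)) =
  al ^+ M *: tstate (gam M) (bv (a + n%:R / k - M%:R / k)) (phi n).
Proof.
elim: M => [|M IH] sM; first by rewrite /= mul0r subr0 expr0 scale1r.
rewrite descendS sub0r IH => [|s ltsM]; last by apply: sM; lia.
rewrite (linZ _ _ (lJ _)) exprSr -scalerA; congr (_ *: _).
set b := a + n%:R / k - M%:R / k.
have sMn : (M < n)%N \/ M = n /\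
    ep * (k * b / 2%:R) - (h + eta * M%:R) / 2%:R + ep * (k + 2%:R^-1) * n%:R = 0.
  case: (sM M (ltnSn M)) => [lt|[E1 E2]]; first by left.
  (* After n factors the momentum is back at [a], which is why the condition is stated with [a]. *)
  by right; split=> //; rewrite /b E1 addrK.
have chi0 p : - n%:Z <= p -> mode X p (tstate (gam M) (bv b) (phi n)) = 0.
  move=> le; rewrite /X /= on3_tstate; last exact: fchi.1.
  by rewrite chi_phi // (lin0 (tstate_lin3 _ _)).
have V0 s : 0 <= s -> mode (VV (- k^-1)) s (tstate (gam M) (bv b) (phi n)) = 0.
  move=> s0; rewrite /VV /= on2_tstate; last exact: (fvp _).1.
  by rewrite vp_bv // (lin0 (tstate_lin2 _ _)).
have V1 : mode (VV (- k^-1)) (- 1) (tstate (gam M) (bv b) (phi n)) =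
    tstate (gam M) (bv (b - k^-1)) (phi n).
  rewrite /VV /= on2_tstate; last exact: (fvp _).1.
  by rewrite vp1_bv.
have F0 p : 0 < p -> mode dF p (tstate (gam M) (bv b) (phi n)) = 0.
  move=> p0; rewrite /dF /= on2_tstate; last exact: fFop.1.
  by rewrite Fop_bv // (lin0 (tstate_lin2 _ _)).
have Fb : mode dF 0 (tstate (gam M) (bv b) (phi n)) =
    (k * b / 2%:R) *: tstate (gam M) (bv b) (phi n).
  rewrite /dF /= on2_tstate; last exact: fFop.1.
  by rewrite Fop0_bv (linZ _ _ (tstate_lin2 _ _)).
have H0 p : 0 < p -> mode H p (tstate (gam M) (bv b) (phi n)) = 0.
  move=> p0; rewrite /H /= on1_tstate; last exact: fHop.1.
  by rewrite Hop_gam // (lin0 (tstate_lin1 _ _)).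
have Hb : mode H 0 (tstate (gam M) (bv b) (phi n)) =
    (h + eta * M%:R) *: tstate (gam M) (bv b) (phi n).
  rewrite /H /= on1_tstate; last exact: fHop.1.
  by rewrite Hop0_gam (linZ _ _ (tstate_lin1 _ _)).
have G0 (p : int) : - M%:Z < p -> mode G p (tstate (gam M) (bv b) (phi n)) = 0.
  move=> lt; rewrite /G /= on1_tstate; last exact: fGam.1.
  by rewrite Gam_gam // (lin0 (tstate_lin1 _ _)).
rewrite /J (curF_top al fG fX fH fdF (fVV _) erefl erefl erefl erefl
  erefl HX FX (VX _) (VG _) (VH _) chi0 V0 V1 F0 Fb H0 Hb G0 sMn).
rewrite /G /= on1_tstate; last exact: fGam.1.
congr (_ *: tstate (Gam _ _) (bv _) _); first by lia.
by rewrite /b -[M.+1%:R]natr1 mulrDl mul1r opprD addrA.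
Qed.

(* The [E]'s are moved to the right, where they act on the pure tensor of vacua:
   there their product is [phi_(-n) ... phi_(-1)] times a shift of the momentum. *)
Lemma charged_product a n M : (forall s, (s < M)%N -> (s < n)%N \/ s = n /\
    ep * (k * a / 2%:R) - (h + eta * n%:R) / 2%:R + ep * (k + 2%:R^-1) * n%:R = 0) ->
  descend E (- 1) n (descend J 0 M (tstate v (bv a) fv)) =
  ((-1) ^+ (M * n + n) * al ^+ M) *:
    tstate (descend Gam 0 M v) (bv (a + n%:R / k - M%:R / k))
      (descend chi (- 1) n fv).
Proof.
move=> sM; have EJ i j w : E j (J i w) = -1 *: J i (E j w).
  by rewrite JE scaleN1r opprK.
rewrite (descend_descend _ _ _ _ _ lJ lE EJ) descend_E (descendZ _ _ _ _ lJ).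
by rewrite descend_J // !scalerA exprD.
Qed.

End ChargedProducts.

End TensorOperators.

(** * The Ramond sector *)

Section Ramond.
Variables (K : numFieldType) (k h l : K).
Hypothesis k0 : k != 0.

Let G := @opG K k h l.
Let Q := @opQ K k h l.
Let H := @opH K k h l.

Lemma field_shift (W : lmodType K) (A : int -> W -> W) d :
  isfield A -> isfield (fun n => A (n + d)).
Proof.
move=> [lA sA]; split=> [n|w]; first exact: lA.
by have [N AN] := sA w; exists (N - d) => n le; apply: AN; lia.
Qed.

Let fH : isfield H.
Proof.
split=> [n|w]; first exact: act_linear.
have [N kN] := verma_smooth w; exists N => n le.
by have [_ E _ _] := kN n le; exact: E.
Qed.

Let fG : isfield G.
Proof.
split=> [n|w]; first exact: act_linear.
have [N kN] := verma_smooth w; exists N => n le.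
by have [_ _ E _] := kN n le; exact: E.
Qed.

Let fQ : isfield Q.
Proof.
split=> [n|w]; first exact: act_linear.
have [N kN] := verma_smooth w; exists N => n le.
by have [_ _ _ E] := kN n le; exact: E.
Qed.

Let fpsi : isfield (@oppsi K).
Proof.
split=> [n|w]; first exact: act_linear.
have [N kN] := ffock_smooth w; exists N => n le.
by have [E _] := kN n le; exact: E.
Qed.

Let fbpsi : isfield (@opbpsi K).
Proof.
split=> [n|w]; first exact: act_linear.
have [N kN] := ffock_smooth w; exists N => n le.
by have [_ E] := kN n le; exact: E.
Qed.

Let H_v n : 0 < n -> H n (vhw k h l) = 0.
Proof. by move=> n0; apply: act_ann; apply: n2_hwH. Qed.

Let H0_v : H 0 (vhw k h l) = h *: vhw k h l.
Proof.
have E := act_ann (n2_rel k) (n2_hwH0 h l).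
rewrite (actB (gen K (n2H 0)) h%:A) act_alg in E.
exact: (subr0_eq E).
Qed.

Let vpC b c : exchanges 1 (@vop K k b) (@vop K k c).
Proof. by move=> m n w; rewrite scale1r bvopC. Qed.

Let H_par n (u : verma k h l) : H n (vpar u) = 1 *: vpar (H n u).
Proof. by rewrite scale1r; exact: opH_vpar. Qed.

Section Instance.
Variables (al ep eta : K) (Gam : int -> verma k h l -> verma k h l).
Variable chi : int -> ffock K -> ffock K.
Hypotheses (fGam : isfield Gam) (fchi : isfield chi).
Hypotheses (Gam_par : forall n u, Gam n (vpar u) = -1 *: vpar (Gam n u))
  (Gam_Gam : forall m n u, Gam m (Gam n u) = - Gam n (Gam m u))
  (H_Gam : forall m n u, H m (Gam n u) = Gam n (H m u) + eta *: Gam (m + n) u)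
  (chi_chi : exchanges (-1) chi chi)
  (Gam_v : forall n, 0 < n -> Gam n (vhw k h l) = 0)
  (chi_v : forall n, 0 <= n -> chi n (fvac K) = 0).

Let field_Gam : vfield (ramond_space k h l) := VField true (fun n => on_n2 (Gam n)).
Let field_chi : vfield (ramond_space k h l) :=
  VField true (fun n => @on_ferm K k h l (chi n)).

(** [state], [on_n2], [on_bos] and [on_ferm] unfold to the abstract tensor operators, so the general
    product applies by conversion, with all its arguments given explicitly. *)
Lemma ramond_product a n M : (forall s, (s < M)%N -> (s < n)%N \/ s = n /\
    ep * (k * a / 2%:R) - (h + eta * n%:R) / 2%:R + ep * (k + 2%:R^-1) * n%:R = 0) ->
  descend (curE field_chi (@fieldV K k h l k^-1)) (- 1) n
    (descend (curF field_Gam field_chi (@fieldH K k h l) (@field_dF K k h l)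
       (@fieldV K k h l (- k^-1)) al ep (k + 2%:R^-1)) 0 M
      (state (vhw k h l) (bvac k a) (fvac K))) =
  ((-1) ^+ (M * n + n) * al ^+ M) *:
    state (descend Gam 0 M (vhw k h l))
      (bvac k (a + n%:R / k - M%:R / k)) (descend chi (- 1) n (fvac K)).
Proof.
exact: (@charged_product K (verma k h l) (bfock k) (ffock K) (ramond_space k h l)
  (@vpar K k h l) (@state K k h l) (@on_n2 K k h l) (@on_bos K k h l) (@on_ferm K k h l)
  (@tstate_lin1 K _ _ _) (@tstate_lin2 K _ _ _) (@tstate_lin3 K _ _ _)
  (@tstate_ind K _ _ _) (@on1_linear K _ _ _) (@on2_linear K _ _ _)
  (@on3_linear K _ _ _ _ (@vpar_linear K k h l)) (@on1_tstate K _ _ _)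
  (@on2_tstate K _ _ _) (@on3_tstate K _ _ _ _ (@vpar_linear K k h l))
  k h al ep eta Gam H (@opF K k) (@vop K k) chi (vhw k h l) (bvac k) (fvac K)
  k0 fGam fH (opF_field k) (bvop_field k) fchi Gam_par H_par Gam_Gam H_Gam chi_chi
  vpC (@bvop_opF K k) (vpar_vhw k h l) Gam_v H_v H0_v chi_v (@bvop_vac K k)
  (@bvop_vac1 K k) (@bopF_vac K k) (@bopF0_vac K k) a n M).
Qed.

End Instance.

Lemma curF1_curF n w : @curF1 K k h l n w =
  curF (@fieldG K k h l) (@field_bpsi K k h l) (@fieldH K k h l) (@field_dF K k h l)
    (@fieldV K k h l (- k^-1)) 1 (- 1) (k + 2%:R^-1) n w.
Proof.
have E (x y z t : ramond_space k h l) (c d : K) :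
    x - y - c *: z - d *: t = 1 *: x + -1 *: y - c *: z + (-1 * d) *: t.
  by rewrite scale1r scaleN1r mulN1r scaleNr.
exact: E.
Qed.

Lemma curF2_curF n w : @curF2 K k h l n w =
  curF (@fieldQ K k h l) (@field_psi K k h l) (@fieldH K k h l) (@field_dF K k h l)
    (@fieldV K k h l (- k^-1)) ((k + 1) / 2%:R) 1 (k + 2%:R^-1) n w.
Proof.
have E (x y z t : ramond_space k h l) (b c d : K) :
    b *: x + y - c *: z + d *: t = b *: x + 1 *: y - c *: z + (1 * d) *: t.
  by rewrite scale1r mul1r.
exact: E.
Qed.

Lemma curE2_curF1_product a n M : (forall s, (s < M)%N -> (s < n)%N \/ s = n /\
    - 1 * (k * a / 2%:R) - (h + 1 * n%:R) / 2%:R + - 1 * (k + 2%:R^-1) * n%:R = 0) ->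
  descend (@curE2 K k h l) (- 1) n
    (descend (@curF1 K k h l) 0 M (state (vhw k h l) (bvac k a) (fvac K))) =
  ((-1) ^+ (M * n + n) * 1 ^+ M) *:
    state (descend (@opG K k h l) (- 1) M (vhw k h l))
      (bvac k (a + n%:R / k - M%:R / k)) (descend (@opbpsi K) (- 1) n (fvac K)).
Proof.
move=> sM; rewrite (funext (fun n => funext (curF1_curF n))).
(* G(z) has weight 2: its mode n is [G_(n-1)], so that the top index 0 of F^1 corresponds to
   [G_(-1)]. *)
rewrite -[X in descend (@opG K k h l) X]add0r -(descend_shift _ (- 1)).
have G_par p u : G (p - 1) (vpar u) = -1 *: vpar (G (p - 1) u).
  by rewrite scaleN1r; exact: opG_vpar.
have G_G m p u : G (m - 1) (G (p - 1) u) = - G (p - 1) (G (m - 1) u).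
  exact: opGG.
have H_G m p u : H m (G (p - 1) u) = G (p - 1) (H m u) + 1 *: G (m + p - 1) u.
  by rewrite scale1r -addrA; exact: opHG.
have b_b : exchanges (-1) (@opbpsi K) (@opbpsi K).
  by move=> m p u; rewrite scaleN1r; exact: opbpsi_opbpsi.
have G_v m : 0 < m -> G (m - 1) (vhw k h l) = 0.
  by move=> m0; apply: act_ann; apply: n2_hwG; lia.
have b_v m : 0 <= m -> @opbpsi K m (fvac K) = 0.
  by move=> m0; apply: act_ann; apply: f_vacb.
exact: (ramond_product 1 (field_shift (- 1) fG) fbpsi G_par G_G H_G b_b G_v b_v sM).
Qed.

Lemma curE1_curF2_product a n M : (forall s, (s < M)%N -> (s < n)%N \/ s = n /\
    1 * (k * a / 2%:R) - (h + -1 * n%:R) / 2%:R + 1 * (k + 2%:R^-1) * n%:R = 0) ->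
  descend (@curE1 K k h l) (- 1) n
    (descend (@curF2 K k h l) 0 M (state (vhw k h l) (bvac k a) (fvac K))) =
  ((-1) ^+ (M * n + n) * ((k + 1) / 2%:R) ^+ M) *:
    state (descend (@opQ K k h l) 0 M (vhw k h l))
      (bvac k (a + n%:R / k - M%:R / k)) (descend (@oppsi K) 0 n (fvac K)).
Proof.
move=> sM; rewrite (funext (fun n => funext (curF2_curF n))).
(* psi(z) has weight 0: its mode n is [psi_(n+1)], so that the top index -1 of E^1 corresponds to
   [psi_0]. *)
rewrite -[X in descend (@oppsi K) X](addNr 1) -(descend_shift _ 1).
have Q_par p u : Q p (vpar u) = -1 *: vpar (Q p u).
  by rewrite scaleN1r; exact: opQ_vpar.
have Q_Q m p u : Q m (Q p u) = - Q p (Q m u) by exact: opQQ.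
have H_Q m p u : H m (Q p u) = Q p (H m u) + -1 *: Q (m + p) u.
  by rewrite scaleN1r; exact: opHQ.
have p_p : exchanges (-1) (fun p => @oppsi K (p + 1)) (fun p => @oppsi K (p + 1)).
  by move=> m p u; rewrite scaleN1r; exact: oppsi_oppsi.
have Q_v m : 0 < m -> Q m (vhw k h l) = 0.
  by move=> m0; apply: act_ann; apply: n2_hwQ.
have p_v m : 0 <= m -> @oppsi K (m + 1) (fvac K) = 0.
  by move=> m0; apply: act_ann; apply: f_vacp; lia.
exact: (ramond_product _ fQ (field_shift 1 fpsi) Q_par Q_Q H_Q p_p Q_v p_v sM).
Qed.

End Ramond.

Lemma scaled_state_congr (K : fieldType) (k h l c c' : K) v v' b b' f f' :
  c = c' -> v = v' -> b = b' -> f = f' ->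
  c *: @state K k h l v (bvac k b) f = c' *: state v' (bvac k b') f'.
Proof. by move=> -> -> -> ->. Qed.

(* In the first case the net vertex-operator shift is -1/k, since there is one
   more F^1 than there are E^2: hence the exponent (2j-1)/k. *)
Theorem theorem5p2 (R : realType) (k j : R[i]) (r : int)
    (hk0 : k != 0) (hk1 : k != - 1) :
  (r <= 0 ->
     Ech r j k =
     (-1) ^ r *:
       state
         (modes (@opG _ k (n2h r j k) (n2l r j k)) (r - 1) (- 1)
            (vhw k (n2h r j k) (n2l r j k)))
         (bvac k ((2%:R * j - 1) / k))
         (modes (@opbpsi _) r (- 1) (fvac _))) /\
  (1 <= r ->
     Ech r j k =
     ((k + 1) / 2%:R) ^ r *:
       state
         (modes (@opQ _ k (n2h r j k) (n2l r j k)) (- r + 1) 0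
            (vhw k (n2h r j k) (n2l r j k)))
         (bvac k (2%:R * j / k))
         (modes (@oppsi _) (- r + 1) 0 (fvac _))).
Proof.
split=> r0; rewrite /Ech /ramond_hw.
  (* There are n factors E^2 and n + 1 factors F^1; only the leftmost of the latter reaches s =
     n. *)
  rewrite r0; have [n rn] : exists n : nat, r = - n%:Z by exists `|r|%N; lia.
  have r1 : r = 0 - n.+1%:Z + 1 by lia.
  have r2 : r = -1 - n%:Z + 1 by lia.
  have r3 : r - 1 = -1 - n.+1%:Z + 1 by lia.
  apply: (etrans (modes_descend _ _ r2)).
  apply: (etrans (congr1 (descend _ _ _) (modes_descend _ _ r1))).
  apply: (etrans (curE2_curF1_product _ hk0 _)) => [s|].
    rewrite ltnS leq_eqVlt => /orP[/eqP ->|lt]; [right | by left].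
    (* Here h = -2j - 2n(k+1), so -(h+n)/2 = j + (k + 1/2) n cancels the other two terms. *)
    split=> //; rewrite /n2h /p1 rn mulrNz -[n%:~R]/(n%:R : R[i]).
    by field; rewrite hk0.
  apply: scaled_state_congr.
  (* (n+1)n is even, which leaves (-1)^n; as -1 is its own inverse, this is (-1)^r for r = -n. *)
  - rewrite expr1n mulr1 rn -exprnN -signr_odd oddD oddM /= andNb addFb signr_odd.
    by rewrite -exprVn invrN1.
  - exact/esym/modes_descend.
  - by rewrite -[n.+1%:R]natr1; field.
  - exact/esym/modes_descend.
rewrite ifF; last by lia.
have [n rn] : exists n : nat, r = n%:Z by exists `|r|%N; lia.
have r1 : - r + 1 = 0 - n%:Z + 1 by lia.
have r2 : - r = -1 - n%:Z + 1 by lia.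
apply: (etrans (modes_descend _ _ r2)).
apply: (etrans (congr1 (descend _ _ _) (modes_descend _ _ r1))).
(* With as many F^2 as E^1, s never reaches n and no coefficient has to vanish. *)
apply: (etrans (curE1_curF2_product _ hk0 _)) => [s|]; first by left.
apply: scaled_state_congr.
(* The sign is trivial because n^2 + n is even. *)
- by rewrite -signr_odd oddD oddM andbb addbb expr0 mul1r rn.
- exact/esym/modes_descend.
- by rewrite addrK.
- exact/esym/modes_descend.
Qed.
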